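(* Let $G$ be a locally compact second countable unimodular group with a fixed Haar measure $m_G$. For every Borel $G$-space $X$ with a cross section $Y$, the transverse measure construction $\mu\mapsto\mu_Y$ is a bijection $$\mathcal{M}^G(X)\longrightarrow\mathcal{M}^{E_G^Y}(Y),\qquad \mu\mapsto\mu_Y .$$
   Context: A Borel $G$-space is a standard Borel space $X$ with a jointly Borel action $G\times X\to X$, $(g,x)\mapsto g.x$. For $Y\subseteq X$ and $x\in X$ put $Y_x=\{g\in G:g.x\in Y\}$. A cross section is a Borel set $Y\subseteq X$ such that for every $x\in X$ the set $Y_x$ is nonempty and locally finite (finite intersection with every compact subset of $G$). $\mathcal{M}(X)$ is the set of $\sigma$-finite Borel measures on $X$, and $\mathcal{M}^G(X)\subset\mathcal{M}(X)$ the set of $G$-invariant ones. For $\mu\in\mathcal{M}^G(X)$ the transverse measure $\mu_Y$ on $Y$ is defined by $\mu_Y(f)=\int_X\sum_{g\in Y_x}f(g.x)\,w(g)\,d\mu(x)$ for Borel $f:Y\to[0,+\infty]$, where $w:G\to[0,+\infty]$ is a Borel function with $\int_Gw\,dm_G=1$; the definition is independent of the choice of $w$. $E_G^Y=\{(y,y')\in Y\times Y: G.y=G.y'\}$, a countable Borel equivalence relation on $Y$. $\mathcal{M}^{E_G^Y}(Y)$ is the set of $\sigma$-finite Borel measures $\nu$ on $Y$ such that $\nu(\mathrm{Dom}(\tau))=\nu(\mathrm{Rng}(\tau))$ for every Borel bijection $\tau:\mathrm{Dom}(\tau)\to\mathrm{Rng}(\tau)$ between Borel subsets of $Y$ with $(y,\tau(y))\in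 E_G^Y$ for all $y\in\mathrm{Dom}(\tau)$. *)

(* Defs.v *)
From HB Require Import structures.
From mathcomp Require Import all_boot all_order all_algebra.
From mathcomp Require Import all_classical all_reals all_analysis.
From mathcomp Require Import measurable_realfun giry.

Set Implicit Arguments.
Unset Strict Implicit.
Unset Printing Implicit Defensive.

Local Open Scope classical_set_scope.
Local Open Scope ring_scope.

HB.structure Definition PreTopologicalGroup := {G of Group G & Topological G}.

HB.mixin Record PreTopologicalGroup_isTopologicalGroup G
    & PreTopologicalGroup G := {
  mulg_continuous : continuous (fun p : G * G => (p.1 * p.2)%g) ;
  invg_continuous : continuous (fun g : G => g^-1%g) }.

#[short(type="topologicalGroupType")]
HB.structure Definition TopologicalGroup :=
  {G of PreTopologicalGroup G & PreTopologicalGroup_isTopologicalGroup G}.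

(* Measurable types are pointed in the library: [pointed_group] and [pointed_cs]
   only serve to provide a base point. *)
Definition pointed_group (G : topologicalGroupType) : Type := G.

HB.instance Definition _ (G : topologicalGroupType) :=
  Choice.copy (pointed_group G) G.
HB.instance Definition _ (G : topologicalGroupType) :=
  isPointed.Build (pointed_group G) 1%g.

Definition borel_group (G : topologicalGroupType) : Type := G.

HB.instance Definition _ (G : topologicalGroupType) :=
  Measurable.copy (borel_group G)
    (@g_sigma_algebraType (pointed_group G) (@open G)).

(* Borel measures on a second countable locally compact Hausdorff space that are
   finite on compact sets are automatically Radon, so no regularity is asked. *)
Record haar_measure (R : realType) (G : topologicalGroupType)
    (m : {measure set (borel_group G) -> \bar R}) : Prop := {
  haar_compact_fin : forall K : set G, compact K -> (m K < +oo)%E ;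
  haar_neq0 : m [set: G] <> 0%E ;
  haar_left_invariant : forall (g : G) (A : set (borel_group G)),
    measurable A -> m [set (g * h)%g | h in A] = m A }.

Definition unimodular (R : realType) (G : topologicalGroupType) : Prop :=
  forall m : {measure set (borel_group G) -> \bar R}, haar_measure m ->
  forall (g : G) (A : set (borel_group G)),
    measurable A -> m [set (h * g)%g | h in A] = m A.

(* The measurable space [X] is Borel isomorphic to a Polish space, that is,
   to a complete separable pseudometric space that is Hausdorff. *)
Definition standard_borel (R : realType) d (X : measurableType d) : Prop :=
  exists (P : completePseudoMetricType R) (f : X -> P),
    [/\ hausdorff_space P,
        exists2 D : set P, countable D & dense D,
        bijective f &
        forall A : set X, measurable A <-> <<s @open P >> (f @` A)].

Record borel_action (G : topologicalGroupType) d (X : measurableType d)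
    (act : G -> X -> X) : Prop := {
  act_measurable : measurable_fun [set: borel_group G * X]
    (fun p : borel_group G * X => act p.1 p.2) ;
  act_one : forall x, act 1%g x = x ;
  act_mul : forall g h x, act (g * h)%g x = act g (act h x) }.

Definition return_set (G X : Type) (act : G -> X -> X) (Y : set X) (x : X) :
  set G := [set g | Y (act g x)].

Record cross_section (G : topologicalGroupType) d (X : measurableType d)
    (act : G -> X -> X) := CrossSection {
  cs_set : set X ;
  cs_measurable : measurable cs_set ;
  cs_nonempty : forall x, return_set act cs_set x !=set0 ;
  cs_locally_finite : forall x (K : set G), compact K ->
    finite_set (return_set act cs_set x `&` K) }.

Section cross_section_space.
Context (G : topologicalGroupType) d (X : measurableType d) (act : G -> X -> X).

Definition pointed_cs (Y : cross_section act) : Type := set_type (cs_set Y).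

Definition cs_space (Y : cross_section act) : Type := set_type (cs_set Y).

Variable Y : cross_section act.

Lemma cs_point_subproof : exists x : X, x \in cs_set Y.
Proof.
by have [g Yg] := cs_nonempty Y point; exists (act g point); exact/mem_set.
Qed.

HB.instance Definition _ := Choice.copy (pointed_cs Y) (set_type (cs_set Y)).
HB.instance Definition _ := isPointed.Build (pointed_cs Y)
  (exist _ _ (svalP (cid cs_point_subproof))).

Definition cs_val (y : cs_space Y) : X := sval y.

(* The measurable sets are the [cs_val @^-1` A] with [A] measurable in [X]; as
   [cs_set Y] is measurable, these are the measurable subsets of [Y]. *)
HB.instance Definition _ := Measurable.copy (cs_space Y)
  (@g_sigma_algebra_preimageType _ (pointed_cs Y) X cs_val).

(* The extension of [f] from [Y] to [X] by 0; only its values on [Y] matter. *)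
Definition cs_extend (R : realType) (f : cs_space Y -> \bar R) : X -> \bar R :=
  'valL_ 0%E f.

Definition orbit_rel (y y' : cs_space Y) : Prop :=
  range (act^~ (cs_val y)) = range (act^~ (cs_val y')).

End cross_section_space.

Coercion cs_space : cross_section >-> Sortclass.

Definition action_invariant (R : realType) (G : topologicalGroupType) d
    (X : measurableType d) (act : G -> X -> X)
    (mu : {sigma_finite_measure set X -> \bar R}) : Prop :=
  forall (g : G) (A : set X), measurable A -> pushforward mu (act g) A = mu A.

Definition orbit_rel_invariant (R : realType) (G : topologicalGroupType) d
    (X : measurableType d) (act : G -> X -> X) (Y : cross_section act)
    (nu : {sigma_finite_measure set Y -> \bar R}) : Prop :=
  forall (D E : set Y) (tau : Y -> Y),
    measurable D -> measurable E -> measurable_fun D tau ->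
    set_bij D E tau -> (forall y, D y -> orbit_rel y (tau y)) ->
    nu D = nu E.

Record transverse_weight (R : realType) (G : topologicalGroupType)
    (m : {measure set (borel_group G) -> \bar R}) (w : borel_group G -> \bar R) :
    Prop := {
  weight_measurable : measurable_fun [set: borel_group G] w ;
  weight_ge0 : forall g, (0 <= w g)%E ;
  weight_integral : (\int[m]_g w g = 1)%E }.

Definition transverse_functional (R : realType) (G : topologicalGroupType) d
    (X : measurableType d) (act : G -> X -> X) (Y : cross_section act)
    (w : borel_group G -> \bar R) (mu : {measure set X -> \bar R})
    (f : Y -> \bar R) : \bar R :=
  (\int[mu]_x \esum_(g in return_set act (cs_set Y) x)
    (cs_extend f (act g x) * w g))%E.

(* [nu] is the measure on [Y] whose integral is the functional above. *)
Definition is_transverse_measure (R : realType) (G : topologicalGroupType) d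
    (X : measurableType d) (act : G -> X -> X) (Y : cross_section act)
    (w : borel_group G -> \bar R) (mu : {measure set X -> \bar R})
    (nu : {measure set Y -> \bar R}) : Prop :=
  forall f : Y -> \bar R, measurable_fun [set: Y] f -> (forall y, 0 <= f y)%E ->
    (\int[nu]_y f y)%E = transverse_functional w mu f.

(* Main.v *)
Require Import Defs.
From HB Require Import structures.
From mathcomp Require Import all_boot all_order all_algebra.
From mathcomp Require Import all_classical all_reals all_analysis.
From mathcomp Require Import measurable_realfun giry.

Set Implicit Arguments.
Unset Strict Implicit.
Unset Printing Implicit Defensive.

Import Order.TTheory GRing.Theory Num.Theory.

Local Open Scope classical_set_scope.
Local Open Scope ring_scope.

(** The theorem rests on one identity between a measure [mu] on [X] and a measure
    [nu] on [Y], the predicate [mecke]: for all measurable [F >= 0] on [G * X],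
      [\int_X \sum_(g in Y_x) F(g, gx) dmu(x) = \int_Y \int_G F(g, y) dm(g) dnu(y)].
    For an invariant [mu] it says exactly that [nu] is the transverse measure of
    [mu]. In one direction take [F(g, y) = w(g) f(y)] ([mecke_transverse]). In the
    other, the left side is invariant under right translation of [g], so that
    averaging over the group replaces the weight [w] by 1 ([transverse_mecke]);
    this uses that Haar measure is invariant under both translations and under
    inversion ([haar_integral_inv]).

    Invariance of [nu] ([mecke_orbit_invariant]): a partial isomorphism [tau] of
    the orbit relation is [tau(y) = phi(y).y] for a measurable [phi], and
    [g |-> phi(gx) g] maps the returns of [x] to the domain of [tau] bijectively
    onto the returns to its range; left invariance of Haar measure concludes.

    Injectivity ([mecke_injective]): if [beta] is measurable with [beta(x).x] in
    [Y], then the left side for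
    [F(g, y) = f(g^-1 y)] if [beta(g^-1 y) = g], and 0 otherwise, is the integral of
    [f] over [mu], whereas the right side depends on [nu] only.

    Surjectivity: the same formula defines [mu] from [nu] ([spread_measure]). That
    this [mu] satisfies the identity is the mass transport principle for [nu]
    ([mass_transport]),
      [\int_Y \sum_(k in Y_y) H(k, ky) dnu = \int_Y \sum_(k in Y_y) H(k^-1, y) dnu],
    which is the invariance of [nu] under countably many partial isomorphisms whose
    graphs cover the orbit relation. Invariance of [mu] follows because any two
    ways of selecting one return for each point define the same [mu]
    ([spread_invariant]).

    All of this needs the sums over return sets to be measurable, and [beta] to
    exist. Both follow once the return sets are enumerated by countably many
    measurable functions ([return_set_enumeration]), a case of the Lusin-Novikov
    uniformization theorem. Since return sets are closed and [G] is
    sigma-compact, it is enough that a measurable subset of [G * X] with closed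
    sections has a measurable projection over each compact set
    ([measurable_proj_compact]). This is derived from Novikov's separation theorem
    for sequences of analytic sets ([novikov_separation]), which is proved here
    for a combinatorial notion of analytic set. *)

(** * Analytic sets *)

Definition agree (n : nat) (s t : nat -> nat) : Prop :=
  forall i, (i < n)%N -> s i = t i.

Definition baire_closed (C : set (nat -> nat)) : Prop :=
  forall s, (forall n, exists2 t, C t & agree n s t) -> C s.

(** Continuity on [C] for the topology generated by the members of [E] and their
    complements. When [E] is a countable family that generates a standard Borel
    space and separates its points, the sets called [analytic] below are the
    analytic sets of that space. Fixing [E] instead of a topology makes Borel
    isomorphisms harmless and turns continuity into a finite condition. *)
Definition loc_const (T : Type) (E : set (set T)) (C : set (nat -> nat))
    (f : (nat -> nat) -> T) : Prop :=
  forall s U, C s -> E U ->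
    exists n, forall t, C t -> agree n s t -> (U (f t) <-> U (f s)).

Definition analytic (T : Type) (E : set (set T)) (A : set T) : Prop :=
  exists C f, [/\ baire_closed C, loc_const E C f & f @` C = A].

Definition separating (T : Type) (E : set (set T)) : Prop :=
  forall x y, x <> y -> exists2 U, E U & (U x /\ ~ U y) \/ (U y /\ ~ U x).

(** The coordinates of a point of the Baire space seen as a sequence of points
    of the Baire space. *)
Definition slice (s : nat -> nat) (i : nat) : nat -> nat :=
  fun j => s (pickle (i, j)).

Definition unslice (u : nat -> nat -> nat) : nat -> nat :=
  fun t => if unpickle t is Some (i, j) then u i j else 0%N.

Lemma unsliceK u i : slice (unslice u) i = u i.
Proof. by apply/funext => j; rewrite /slice /unslice pickleK. Qed.

Lemma agree_trans n s t u : agree n s t -> agree n t u -> agree n s u.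
Proof. by move=> st tu i ni; rewrite st // tu. Qed.

Lemma agreeW m n s t : (m <= n)%N -> agree n s t -> agree m s t.
Proof. by move=> mn st i im; apply: st; exact: leq_trans im mn. Qed.

(** Continuity of the projection to the slice [i]. *)
Lemma slice_agree i n : exists N, forall s t, agree N s t ->
  agree n (slice s i) (slice t i).
Proof.
exists (\max_(j < n) (pickle (i, nat_of_ord j)).+1) => s t st j jn; apply: st.
exact: (leq_bigmax (Ordinal jn)).
Qed.

Lemma slice_closed i C : baire_closed C ->
  baire_closed [set s | C (slice s i)].
Proof.
move=> cC s Cs; apply: cC => n; have [N HN] := slice_agree i n.
by have [t Ct st] := Cs N; exists (slice t i) => //; exact: HN.
Qed.

Lemma slice_loc_const (T : Type) (E : set (set T)) i C f : loc_const E C f ->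
  loc_const E [set s | C (slice s i)] (fun s => f (slice s i)).
Proof.
move=> fC s U Cs EU; have [n Hn] := fC _ _ Cs EU.
have [N HN] := slice_agree i n; exists N => t Ct st.
by apply: Hn => //; exact: HN.
Qed.

Lemma baire_closedI (I : Type) (C : I -> set (nat -> nat)) :
  (forall i, baire_closed (C i)) -> baire_closed [set s | forall i, C i s].
Proof.
move=> cC s Cs i; apply: cC => n.
by have [t Ct st] := Cs n; exists t.
Qed.

Section analytic_theory.
Variables (T : Type) (E : set (set T)).

Lemma loc_constW (C D : set (nat -> nat)) (f : (nat -> nat) -> T) : D `<=` C ->
  loc_const E C f -> loc_const E D f.
Proof.
move=> DC fC s U Ds EU; have [n Hn] := fC _ _ (DC _ Ds) EU.
by exists n => t Dt; apply: Hn; exact: DC.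
Qed.

Lemma preimage_closed C (f : (nat -> nat) -> T) U : baire_closed C ->
  loc_const E C f -> E U -> baire_closed (C `&` f @^-1` U).
Proof.
move=> cC fC EU s Cs; have Cs' : C s.
  by apply: cC => n; have [t [Ct _] st] := Cs n; exists t.
split=> //=; have [n Hn] := fC _ _ Cs' EU.
have [t [Ct Ut] st] := Cs n.
by apply/(Hn t).
Qed.

Lemma preimage_closedC C (f : (nat -> nat) -> T) U : baire_closed C ->
  loc_const E C f -> E U -> baire_closed (C `&` f @^-1` (~` U)).
Proof.
move=> cC fC EU s Cs; have Cs' : C s.
  by apply: cC => n; have [t [Ct _] st] := Cs n; exists t.
split=> //= Us; have [n Hn] := fC _ _ Cs' EU.
have [t [Ct Ut] st] := Cs n.
by apply: Ut; apply/(Hn t).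
Qed.

Lemma analyticIl A U : analytic E A -> E U -> analytic E (A `&` U).
Proof.
move=> [C [f [cC fC <-]]] EU; exists (C `&` f @^-1` U), f; split.
- exact: preimage_closed.
- exact: loc_constW fC.
- rewrite eqEsubset; split=> [x [s [Cs Us] <-]|x [[s Cs <-] Us]].
    by split => //; exists s.
  by exists s.
Qed.

Lemma analyticDl A U : analytic E A -> E U -> analytic E (A `&` ~` U).
Proof.
move=> [C [f [cC fC <-]]] EU; exists (C `&` f @^-1` (~` U)), f; split.
- exact: preimage_closedC.
- exact: loc_constW fC.
- rewrite eqEsubset; split=> [x [s [Cs Us] <-]|x [[s Cs <-] Us]].
    by split => //; exists s.
  by exists s.
Qed.

Lemma analytic_bigcup (A : nat -> set T) : (forall n, analytic E (A n)) ->
  analytic E (\bigcup_n A n).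
Proof.
move=> /choice[C] /choice[f] H.
(* the first coordinate tells which set of the sequence is parametrized *)
pose sh (s : nat -> nat) := fun i => s i.+1.
have shP n s t : agree n.+1 s t -> s 0%N = t 0%N /\ agree n (sh s) (sh t).
  by move=> st; split=> [|i ni]; apply: st.
exists [set s | C (s 0%N) (sh s)], (fun s => f (s 0%N) (sh s)); split.
- move=> s Cs /=; have [cC _ _] := H (s 0%N); apply: cC => n.
  by have [t Ct /shP[st0 st]] := Cs n.+1; exists (sh t) => //; rewrite st0.
- move=> s U Cs EU; have [_ fC _] := H (s 0%N).
  have [n Hn] := fC _ _ Cs EU; exists n.+1 => t Ct /shP[st0 st].
  by rewrite -st0; apply: Hn; rewrite // st0.
- rewrite eqEsubset; split=> [x [s Cs <-]|x [n _]].
    by exists (s 0%N) => //; have [_ _ <-] := H (s 0%N); exists (sh s).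
  have [_ _ <-] := H n => -[s Cs <-].
  by exists (fun i => if i is j.+1 then s j else n).
Qed.

Lemma analytic_bigcap (A : nat -> set T) : separating E ->
  (forall n, analytic E (A n)) -> analytic E (\bigcap_n A n).
Proof.
move=> sepE /choice[C] /choice[f] H.
pose D := [set s | forall n, (C n) (slice s n)].
have cD : baire_closed D.
  by apply: baire_closedI => n; apply: slice_closed; have [] := H n.
have fD n : loc_const E D (fun s => f n (slice s n)).
  apply: (@loc_constW [set s | C n (slice s n)]); first by move=> s; exact.
  by apply: slice_loc_const; have [] := H n.
exists [set s | D s /\ forall n, f n (slice s n) = f 0%N (slice s 0%N)].
exists (fun s => f 0%N (slice s 0%N)); split.
(* two distinct values are told apart by a member of [E], hence already by a
   finite part of the sequence; so the equations define a closed set *)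
- move=> s Ds; have Ds' : D s.
    by apply: cD => n; have [t [Dt _] st] := Ds n; exists t.
  split=> // n; apply: contrapT => /sepE[U EU Us].
  have [p Hp] := fD n _ _ Ds' EU; have [q Hq] := fD 0%N _ _ Ds' EU.
  have [t [Dt tn] st] := Ds (maxn p q).
  have := Hp t Dt (agreeW (leq_maxl _ _) st).
  have := Hq t Dt (agreeW (leq_maxr _ _) st).
  by rewrite tn => -> => e; case: Us => -[]; rewrite e.
- by apply: loc_constW (fD 0%N) => s [].
- rewrite eqEsubset; split=> [x [s [Ds sn] <-] n _|x Ax].
    by have [_ _ <-] := H n; exists (slice s n) => //; exact: Ds.
  have /choice[u Hu] : forall n, exists s, C n s /\ f n s = x.
    by move=> n; have [_ _ eA] := H n; have := Ax n I; rewrite -eA => -[s]; exists s.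
  exists (unslice u); last by rewrite unsliceK; exact: (Hu 0%N).2.
  split=> [n|n]; rewrite !unsliceK; first exact: (Hu n).1.
  by rewrite (Hu n).2 (Hu 0%N).2.
Qed.

End analytic_theory.

Section analytic_sigma.
Variables (T : Type) (E : set (set T)).
Hypothesis sepE : separating E.

Lemma analyticI A B : analytic E A -> analytic E B -> analytic E (A `&` B).
Proof.
move=> hA hB; rewrite -bigcap2inE.
rewrite (_ : \bigcap_(i < 2) _ = \bigcap_n (if n is 0%N then A else B)).
  by apply: analytic_bigcap => // -[].
rewrite eqEsubset; split=> x Hx.
- by case=> [|n] _; [exact: (Hx 0%N)|exact: (Hx 1%N)].
- by case=> [|[|//]] _; [exact: (Hx 0%N)|exact: (Hx 1%N)].
Qed.

Lemma analyticU A B : analytic E A -> analytic E B -> analytic E (A `|` B).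
Proof.
move=> hA hB.
rewrite (_ : A `|` B = \bigcup_n (if n is 0%N then A else B)).
  by apply: analytic_bigcup => // -[].
rewrite eqEsubset; split=> [x [Ax|Bx]|x [[|n] _ /= ?]].
- by exists 0%N.
- by exists 1%N.
- by left.
- by right.
Qed.

Hypothesis anT : analytic E setT.

(** The sets that are analytic together with their complement form a
    sigma-algebra, which contains [E]. *)
Lemma analytic_sigma A : <<s E >> A -> analytic E A.
Proof.
move=> EA; suff: analytic E A /\ analytic E (~` A) by case.
have an0 : analytic E set0.
  case: anT => C [f [_ _ _]]; exists set0, f; split => //.
  - by move=> s /(_ 0%N)[].
  - by rewrite image_set0.
apply: (EA [set A | analytic E A /\ analytic E (~` A)]); split.
- split=> [|B [aB aBc]|F aF].
  + by split; rewrite ?setC0.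
  + by rewrite setTD; split; rewrite ?setCK.
  + split; first by apply: analytic_bigcup => n; have [] := aF n.
    by rewrite setC_bigcup; apply: analytic_bigcap => // n; have [] := aF n.
- move=> U EU; split.
  + by have := analyticIl anT EU; rewrite setTI.
  + by have := analyticDl anT EU; rewrite setTI.
Qed.

End analytic_sigma.

Definition prod_family (T1 T2 : Type) (E1 : set (set T1)) (E2 : set (set T2)) :
    set (set (T1 * T2)) :=
  [set fst @^-1` U | U in E1] `|` [set snd @^-1` U | U in E2].

Lemma separating_prod T1 T2 (E1 : set (set T1)) (E2 : set (set T2)) :
  separating E1 -> separating E2 -> separating (prod_family E1 E2).
Proof.
move=> s1 s2 [x1 x2] [y1 y2] xy.
have [e1|/s1[U EU HU]] := pselect (x1 = y1); last first.
  by exists (fst @^-1` U) => //; left; exists U.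
have [e2|/s2[U EU HU]] := pselect (x2 = y2); first by case: xy; rewrite e1 e2.
by exists (snd @^-1` U) => //; right; exists U.
Qed.

Lemma analytic_setX T1 T2 (E1 : set (set T1)) (E2 : set (set T2)) A B :
  analytic E1 A -> analytic E2 B -> analytic (prod_family E1 E2) (A `*` B).
Proof.
move=> [C1 [f1 [cC1 fC1 <-]]] [C2 [f2 [cC2 fC2 <-]]].
exists [set s | C1 (slice s 0%N) /\ C2 (slice s 1%N)].
exists (fun s => (f1 (slice s 0%N), f2 (slice s 1%N))); split.
- move=> s Cs; split.
  + by apply: (slice_closed cC1) => n; have [t [Ct _] st] := Cs n; exists t.
  + by apply: (slice_closed cC2) => n; have [t [_ Ct] st] := Cs n; exists t.
- move=> s U [C1s C2s] [[V EV <-]|[V EV <-]] /=.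
  + have [n Hn] := @slice_loc_const _ _ 0%N _ _ fC1 s V C1s EV.
    by exists n => t [Ct _]; exact: Hn.
  + have [n Hn] := @slice_loc_const _ _ 1%N _ _ fC2 s V C2s EV.
    by exists n => t [_ Ct]; exact: Hn.
- rewrite eqEsubset; split=> [_ [s [C1s C2s] <-]|[x y] [/= [s1 Cs1 <-] [s2 Cs2 <-]]].
    by split; [exists (slice s 0%N)|exists (slice s 1%N)].
  exists (unslice (fun i => if i is 0%N then s1 else s2)).
    by split; rewrite unsliceK.
  by rewrite !unsliceK.
Qed.

Lemma analytic_proj T1 T2 (E1 : set (set T1)) (E2 : set (set T2)) A :
  analytic (prod_family E1 E2) A -> analytic E2 (snd @` A).
Proof.
move=> [C [f [cC fC <-]]]; exists C, (snd \o f); split=> //.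
- move=> s U Cs EU; apply: (fC s (snd @^-1` U) Cs).
  by right; exists U.
- by rewrite -image_comp.
Qed.

(** * Separation of analytic sets *)

Section novikov.
Context d (T : measurableType d) (E : set (set T)).
Hypothesis mE : E `<=` measurable.
Hypothesis sepE : separating E.

Definition separated (A : nat -> set T) : Prop :=
  exists B : nat -> set T, [/\ forall n, measurable (B n),
    forall n, A n `<=` B n & \bigcap_n B n = set0].

(** If the pieces of one member of a sequence can all be separated from the
    other members, intersecting the separating sets of the other members over
    all pieces separates the whole sequence. *)
Lemma separated_split (A : nat -> set T) i (P : nat -> set T) :
  A i `<=` \bigcup_v P v ->
  (forall v, separated (fun n => if n == i then P v else A n)) -> separated A.
Proof.
move=> AP /choice[B HB].
exists (fun n => if n == i then \bigcup_v B v n else \bigcap_v B v n).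
split=> [n|n x Ax|].
-  case: ifP => _.
    by apply: bigcup_measurable => v _; have [] := HB v.
  by apply: bigcap_measurable => [|v _]; [exists 0%N|have [] := HB v].
- case: ifP => [/eqP ni|ni].
    have [v _ Px] : (\bigcup_v P v) x by apply: AP; rewrite -ni.
    by exists v => //; have [_ + _] := HB v => /(_ n); rewrite ni eqxx; apply.
  by move=> v _; have [_ + _] := HB v => /(_ n); rewrite ni; apply.
rewrite -subset0 => x Bx.
have /= := Bx i I; rewrite eqxx => -[v _ Bvi].
have [_ _ B0] := HB v; suff : (\bigcap_n B v n) x by rewrite B0.
move=> n _.
have /= := Bx n I; case: eqP => [->//|_]; exact.
Qed.

Lemma separated_pair (A : nat -> set T) i j U V : i <> j ->
  measurable U -> measurable V -> A i `<=` U -> A j `<=` V ->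
  U `&` V = set0 -> separated A.
Proof.
move=> ij mU mV AU AV UV.
exists (fun n => if n == i then U else if n == j then V else setT).
split=> [n|n|]; first by do 2 case: ifP => // _.
  by case: eqP => [->//|_]; case: eqP => [->|].
rewrite -subset0 -UV => x Bx; split.
  by have := Bx i I; rewrite eqxx.
have := Bx j I; rewrite eqxx; case: eqP => // ji.
by case: ij.
Qed.

(** Novikov's separation theorem. If a sequence cannot be separated, then some
    coordinate of some parametrization can be prescribed so that the shrunken
    sequence still cannot be separated. Prescribing all coordinates in turn
    gives one point in every set of the sequence; two distinct such points would
    be separated by a member of [E], so they are all equal and the intersection
    of the sequence is not empty. *)
Lemma novikov_separation (A : nat -> set T) : (forall n, analytic E (A n)) ->
  \bigcap_n A n = set0 -> separated A.
Proof.
move=> /choice[C] /choice[f] H A0.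
(* the part of [A i] parametrized by the sequences that agree with
   the slice [i] of [s] as far as the first [t] values of [s] prescribe it; passing
   from [t] to [t.+1] changes at most one member of the sequence *)
pose piece (s : nat -> nat) (t i : nat) : set T :=
  [set f i u | u in [set u | C i u /\
     forall j : nat, (pickle (i, j) < t)%N -> u j = slice s i j]].
have piece0 s : piece s 0%N = A.
  apply/funext => i; have [_ _ <-] := H i; rewrite eqEsubset.
  by split=> x [u]; [case=> Cu _ <-; exists u|move=> Cu <-; exists u].
have piece_agree s s' t : agree t s s' -> piece s t = piece s' t.
  move=> ss'; apply/funext => i; rewrite eqEsubset.
  split=> x [u [Cu Hu] <-]; exists u => //; split=> // j jt; rewrite Hu //.
    exact: ss'.
  by rewrite /slice ss'.
apply: contrapT => nsep.
pose upd (s : nat -> nat) (t v : nat) := fun i : nat => if i == t then v else s i.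
have updP s t v : agree t s (upd s t v).
  by move=> i it; rewrite /upd; case: eqP => // e; move: it; rewrite e ltnn.
have pieceS s t v (n : nat) : (forall j : nat, pickle (n, j) <> t) ->
    piece (upd s t v) t.+1 n = piece s t n.
  move=> nt; rewrite (piece_agree _ _ _ (updP s t v)) eqEsubset.
  split=> x [u [Cu Hu] <-]; exists u => //; split=> // j jt.
    by apply: Hu; rewrite ltnS ltnW.
  by apply: Hu; move: jt; rewrite ltnS leq_eqVlt => /orP[/eqP e|//]; case: (nt j).
have step s t : ~ separated (piece s t) ->
    exists v, ~ separated (piece (upd s t v) t.+1).
  move=> ns; apply: contrapT => /forallNP allsep; apply: ns.
  have [[[i j] et]|nt] := pselect (exists ij : nat * nat, pickle ij = t); last first.
    have /contrapT := allsep 0%N; congr separated.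
    by apply/funext => n; apply: pieceS => j e; apply: nt; exists (n, j).
  apply: (@separated_split _ i (fun v => piece (upd s t v) t.+1 i)).
    move=> x [u [Cu Hu] <-]; exists (u j) => //; exists u => //; split=> // j'.
    rewrite ltnS leq_eqVlt => /orP[/eqP|] e.
      move: e; rewrite -et => /(pcan_inj pickleK)[->].
      by rewrite /slice /upd eqxx.
    by rewrite Hu // /slice -(updP s t (u j)).
  move=> v; have /contrapT := allsep v; congr separated.
  apply/funext => n; case: eqP => [->//|ni]; apply: pieceS => j'.
  by rewrite -et => /(pcan_inj pickleK)[].
have [s Hs] : exists s, forall t, ~ separated (piece s t).
  have /choice[g Hg] : forall p : (nat -> nat) * nat, exists v,
      ~ separated (piece p.1 p.2) -> ~ separated (piece (upd p.1 p.2 v) p.2.+1).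
    move=> [s t]; have [ns|ns] := pselect (~ separated (piece s t)).
      by have [v Hv] := step _ _ ns; exists v.
    by exists 0%N.
  pose S := fix S n := if n is t.+1 then upd (S t) t (g (S t, t)) else fun=> 0%N.
  have SS n m : agree n (S n) (S (n + m)%N).
    elim: m => [|m IH]; first by rewrite addn0.
    apply: agree_trans IH _; rewrite addnS /=.
    by apply: agreeW (updP _ _ _); exact: leq_addr.
  exists (fun i => S i.+1 i) => t.
  have <- : piece (S t) t = piece (fun i => S i.+1 i) t.
    by apply: piece_agree => i it; rewrite -(subnKC it); symmetry; exact: SS.
  elim: t => [|t IH]; first by rewrite piece0.
  exact: (Hg (S t, t)).
have ne i t : exists x, piece s t i x.
  apply: contrapT => np; apply: (Hs t).
  exists (fun n => if n == i then set0 else setT).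
  split=> [n|n x|]; first by case: ifP => _.
    by case: eqP => [->|//] px; case: np; exists x.
  by rewrite -subset0 => x /(_ i I); rewrite eqxx.
have near_slice (i n : nat) : exists N, forall u,
    (forall j : nat, (pickle (i, j) < N)%N -> u j = slice s i j) -> agree n (slice s i) u.
  have [N HN] := slice_agree i n; exists N => u Hu j jn; symmetry.
  pose s' := unslice (fun i' => if i' == i then u else slice s i').
  pose s'' := fun k => if (k < N)%N then s k else s' k.
  have /(_ j jn) : agree n (slice s i) (slice s'' i).
    by apply: HN => k kN; rewrite /s'' kN.
  rewrite {2}/slice /s''; case: ifP => [kN _|_ ->]; first exact: Hu.
  by rewrite /s' /unslice pickleK eqxx.
have Cs i : C i (slice s i).
  have [cC _ _] := H i; apply: cC => n.
  have [N HN] := near_slice i n; have [x [u [Cu Hu] _]] := ne i N.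
  by exists u => //; exact: HN.
have loc i U : E U -> exists N, forall t, (N <= t)%N ->
    forall x, piece s t i x -> (U x <-> U (f i (slice s i))).
  move=> EU; have [_ fC _] := H i; have [n Hn] := fC _ _ (Cs i) EU.
  have [N HN] := near_slice i n; exists N => t Nt x [u [Cu Hu] <-].
  by apply: Hn => //; apply: HN => j jN; apply: Hu; exact: leq_trans jN Nt.
suff eqs i j : f i (slice s i) = f j (slice s j).
  suff : (\bigcap_n A n) (f 0%N (slice s 0%N)) by rewrite A0.
  move=> n _; have [_ _ <-] := H n.
  by exists (slice s n) => //; exact: eqs.
have sepij i' j' U : E U -> U (f i' (slice s i')) -> ~ U (f j' (slice s j')) -> False.
  move=> EU Ui Uj; have [N HN] := loc i' U EU; have [M HM] := loc j' U EU.
  have ij : i' <> j' by move=> e; apply: Uj; rewrite -e.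
  apply: (Hs (maxn N M)); apply: (separated_pair ij (mE EU) (measurableC (mE EU))).
  - by move=> x /(HN _ (leq_maxl _ _)) ->.
  - by move=> x /(HM _ (leq_maxr _ _)) e; move/e.
  - exact: setICr.
by apply: contrapT => /sepE[U EU [[Ui Uj]|[Uj Ui]]]; apply: (sepij _ _ U EU); eauto.
Qed.

Lemma lusin_separation (A B : set T) : analytic E A -> analytic E B ->
  A `&` B = set0 -> exists2 M, measurable M & A `<=` M /\ M `&` B = set0.
Proof.
move=> hA hB AB.
have [||M [mM sM M0]] := @novikov_separation (fun n => if n is 0%N then A else B).
- by case.
- rewrite -subset0 -AB => x Hx; split; [exact: (Hx 0%N)|exact: (Hx 1%N)].
exists (M 0%N) => //; split; first exact: sM 0%N.
rewrite -subset0 -M0 => x [Mx Bx] [|n] _ //.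
by apply: (sM n.+1).
Qed.

End novikov.

(** * Standard Borel spaces and second countable locally compact groups *)

(** The measurable spaces to which the separation theorems apply: standard Borel
    spaces and second countable locally compact groups. *)
Record analytic_space d (T : measurableType d) (E : set (set T)) : Prop := {
  analytic_measurable : E `<=` measurable ;
  analytic_generate : measurable `<=` <<s E >> ;
  analytic_separating : separating E ;
  analytic_setT : analytic E setT }.

Lemma sigma_algebra_preimage (T U : Type) (f : T -> U) (E : set (set U))
    (F : set (set T)) : (forall V, E V -> <<s F >> (f @^-1` V)) ->
  forall B, <<s E >> B -> <<s F >> (f @^-1` B).
Proof.
move=> EF B EB.
have [F0 FC FU] := smallest_sigma_algebra setT F.
apply: (EB [set B | <<s F >> (f @^-1` B)]); split => //.
split=> [|A FA|A FA].
- by rewrite /= preimage_set0.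
- by have := FC _ FA; rewrite /= !setTD preimage_setC.
- by rewrite /= preimage_bigcup; exact: FU.
Qed.

Lemma analytic_space_measurable d (T : measurableType d) (E : set (set T)) A :
  analytic_space E -> measurable A -> analytic E A.
Proof.
by move=> [mE gE sE aE] mA; apply: analytic_sigma => //; exact: gE.
Qed.

Lemma analytic_space_prod d1 d2 (T1 : measurableType d1) (T2 : measurableType d2)
    (E1 : set (set T1)) (E2 : set (set T2)) :
  analytic_space E1 -> analytic_space E2 ->
  @analytic_space _ (T1 * T2)%type (prod_family E1 E2).
Proof.
move=> [m1 g1 s1 a1] [m2 g2 s2 a2]; split.
- move=> U [[V EV <-]|[V EV <-]]; rewrite -[X in measurable X]setTI.
  + by apply: measurable_fst => //; exact: m1.
  + by apply: measurable_snd => //; exact: m2.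
- apply: smallest_sub; first exact: smallest_sigma_algebra.
  rewrite subUset; split=> _ [A mA <-]; rewrite setTI.
  + apply: (sigma_algebra_preimage _ (g1 _ mA)) => V EV.
    by apply: sub_sigma_algebra; left; exists V.
  + apply: (sigma_algebra_preimage _ (g2 _ mA)) => V EV.
    by apply: sub_sigma_algebra; right; exists V.
- exact: separating_prod.
- by rewrite -setXTT; exact: analytic_setX.
Qed.

Definition base_seq (T : topologicalType) (V : nat -> set T) : Prop :=
  (forall n, open (V n)) /\
  forall x U, open U -> U x -> exists n, V n x /\ V n `<=` U.

Lemma second_countable_base (T : topologicalType) : @second_countable T ->
  exists V : nat -> set T, base_seq V.
Proof.
move=> [B /countable_injP[g gB] [oB bB]].
exists (fun n => \bigcup_(U in [set U | B U /\ g U = n]) U); split=> [n|x U oU Ux].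
  by apply: bigcup_open => U [BU _]; exact: oB.
have [W [BW Wx] WU] := bB x U (open_nbhs_nbhs (conj oU Ux)).
exists (g W); split; first by exists W.
move=> y [W' [BW' e] W'y]; apply: WU.
by rewrite -(gB _ _ _ _ e) // inE.
Qed.

Lemma base_open_sigma (T : topologicalType) (V : nat -> set T) : base_seq V ->
  @open T `<=` <<s range V >>.
Proof.
move=> [oV bV] U oU.
have -> : U = \bigcup_n (if `[< V n `<=` U >] then V n else set0).
  rewrite eqEsubset; split=> [x Ux|x [n _]].
    by have [n [Vx VU]] := bV x U oU Ux; exists n => //; case: asboolP.
  by case: asboolP => // VU; exact: VU.
have [s0 _ sU] := smallest_sigma_algebra setT (range V).
apply: sU => n /=; case: asboolP => // _.
by apply: sub_sigma_algebra; exists n.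
Qed.

Lemma base_separating (T : topologicalType) (V : nat -> set T) : base_seq V ->
  hausdorff_space T -> separating (range V).
Proof.
move=> [oV bV]; rewrite open_hausdorff => hT x y /eqP/hT[[A B] /= [+ +] [oA oB /eqP AB]].
rewrite !inE => Ax By; have [n [Vx VA]] := bV x A oA Ax.
exists (V n); first by exists n.
left; split=> // /VA Ay; suff : (A `&` B) y by rewrite AB.
by [].
Qed.

Lemma cluster_closed (T : topologicalType) (x : nat -> T) (y : T) (L : set T) N :
  closed L -> (forall n, (N <= n)%N -> L (x n)) -> cluster (x @ \oo) y -> L y.
Proof.
move=> cL Lx xy; apply: cL => B By.
by apply: xy By; exists N => // n /= Nn; exact: Lx.
Qed.

(** A point is coded by two sequences: a sequence of closed sets of a complete
    system that contain it, and a sequence that says of each basic open set [V n]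
    either that the point is outside, or in which basic open set with closure
    inside [V n] it lies. *)
Lemma base_analytic (T : topologicalType) (x0 : T) (V : nat -> set T)
    (K : nat -> nat -> set T) : base_seq V -> hausdorff_space T ->
  regular_space T -> (forall k i, closed (K k i)) ->
  (forall k x, exists i, K k i x) ->
  (forall (s : nat -> nat) (x : nat -> T),
     (forall k n, (k < n)%N -> K k (s k) (x n)) -> cluster (x @ \oo) !=set0) ->
  analytic (range V) setT.
Proof.
move=> bV hT rT cK covK complK.
pose L n j := if j is i.+1 then (if `[< closure (V i) `<=` V n >]
  then closure (V i) else set0) else ~` V n.
have cL n j : closed (L n j).
  case: j => [|i] /=; first by apply: open_closedC; exact: bV.1.
  by case: asboolP => _; [exact: closed_closure|exact: closed0].
have covL n x : exists j, L n j x.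
  have [Vx|Vx] := pselect (V n x); last by exists 0%N.
  have [W Wx WV] := rT x (V n) (open_nbhs_nbhs (conj (bV.1 n) Vx)).
  have [i [Vi ViW]] := bV.2 x (W^°) (open_interior _) Wx.
  exists i.+1 => /=; case: asboolP => [_|[]]; first exact: subset_closure.
  apply: subset_trans WV; apply: closureS.
  exact: subset_trans ViW (@interior_subset _ _).
(* the constraints on the code of a point, interleaved *)
pose F k j := if odd k then L k./2 j else K k./2 j.
have cF k j : closed (F k j) by rewrite /F; case: ifP.
pose C := [set s : nat -> nat | forall n, exists x, forall k, (k < n)%N -> F k (s k) x].
have CP s : C s -> exists y, forall k, F k (s k) y.
  move=> /choice[x Hx].
  have [y xy] : cluster (x \o double @ \oo) !=set0.
    apply: (complK (fun k => s k.*2)) => k n kn /=.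
    have := Hx n.*2 k.*2; rewrite ltn_double kn => /(_ isT).
    by rewrite /F odd_double doubleK.
  exists y => k; apply: (@cluster_closed _ _ _ _ k.+1 _ _ xy) => // n kn /=.
  by apply: Hx; apply: leq_trans kn _; rewrite -addnn leq_addr.
pose f s := xget x0 [set y | forall k, F k (s k) y].
have fP s : C s -> forall k, F k (s k) (f s).
  by move=> /CP Hy; exact: (xgetPex x0 Hy).
have decide n s x y : F n.*2.+1 (s n.*2.+1) x -> F n.*2.+1 (s n.*2.+1) y ->
    (V n x <-> V n y).
  rewrite /F /= odd_double uphalf_double /=; case: (s _) => [|i] //=.
  by case: asboolP => // ViV /ViV ? /ViV ?.
exists C, f; split.
- move=> s Cs n; have [t Ct st] := Cs n; have [x Hx] := Ct n.
  by exists x => k kn; rewrite st //; exact: Hx.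
- move=> s _ Cs [n _ <-]; exists n.*2.+2 => t Ct st.
  apply: (@decide _ s); last exact: fP.
  by rewrite st //; exact: fP.
- rewrite eqEsubset; split=> // x _.
  have /choice[s Hs] : forall k, exists j, F k j x.
    by move=> k; rewrite /F; case: (odd k); [exact: covL|exact: covK].
  have Cs : C s by move=> n; exists x => k _; exact: Hs.
  exists s => //; apply: contrapT => /(base_separating bV hT)[_ [n _ <-]].
  have := @decide n s _ _ (fP _ Cs _) (Hs _); tauto.
Qed.

Lemma countable_enumeration (T : choiceType) (x0 : T) (D : set T) : countable D ->
  exists u : nat -> T, D `<=` range u.
Proof.
move=> /countable_injP[g gD]; exists (fun n => xget x0 [set x | D x /\ g x = n]).
move=> x Dx; exists (g x) => //.
have [Dy e] := xgetPex x0 (ex_intro (fun y => D y /\ g y = g x) x (conj Dx erefl)).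
by apply: gD => //; rewrite inE.
Qed.

Section polish.
Context (R : realType) (P : completePseudoMetricType R) (u : nat -> P).
Hypothesis du : dense (range u).

Let r (k : nat) : R := k.+1%:R^-1.
Let r_gt0 k : 0 < r k. Proof. by rewrite /r invr_gt0. Qed.

Let small_r (e : R) : 0 < e -> exists k, r k + r k <= e.
Proof.
move=> e0; have e20 : 0 < e / 2 by rewrite divr_gt0.
have [k _ /(_ k (leqnn k)) /= Hk] := near_infty_natSinv_lt (PosNum e20).
by exists k; rewrite [leRHS]splitr lerD // ltW.
Qed.

Let near_u x (e : R) : 0 < e -> exists i, ball x e (u i).
Proof.
move=> e0; have [|y [By [i _ iy]]] := du _ (open_interior (ball x e)).
  by exists x; exact: nbhsx_ballx.
by exists i; rewrite iy; exact: interior_subset.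
Qed.

Lemma polish_base : exists V : nat -> set P, base_seq V.
Proof.
pose V n := if unpickle n is Some (i, k) then (ball (u i) (r k))^° else set0.
exists V; split=> [n|x U oU Ux].
  rewrite /V; case: unpickle => [[i k]|]; first exact: open_interior.
  exact: open0.
have /nbhs_ballP[e /= e0 eU] := open_nbhs_nbhs (conj oU Ux).
have [k Hk] := small_r e0; have rk2 : 0 < r k / 2 by rewrite divr_gt0.
have [i Hi] := near_u x rk2.
exists (pickle (i, k)); rewrite /V pickleK; split.
  apply/nbhs_ballP; exists (r k / 2) => //= y xy.
  by rewrite [r k]splitr; apply: ball_triangle xy; exact: ball_sym.
move=> y /interior_subset iy; apply: eU; apply: (le_ball Hk).
apply: ball_triangle iy; apply: le_ball Hi.
by rewrite ler_pdivrMr // ler_peMr // ?ler1n// ltW.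
Qed.

Lemma polish_analytic (V : nat -> set P) : hausdorff_space P -> base_seq V ->
  analytic (range V) setT.
Proof.
move=> hP bV; pose K k i := closure (ball (u i) (r k)).
apply: (@base_analytic _ point V K) => //.
- exact: uniform_regular.
- by move=> k i; exact: closed_closure.
- move=> k x; have [i Hi] := near_u x (r_gt0 k); exists i.
  by apply: subset_closure; exact: ball_sym.
move=> s x Hx; have cx : cauchy (x @ \oo).
  apply: cauchy_exP => e e0; have [k Hk] := small_r e0.
  exists (u (s k)), k.+1 => // n /= kn; apply: (le_ball Hk).
  have [z [uz xz]] := Hx k n kn _ (nbhsx_ballx (x n) (r k) (r_gt0 k)).
  exact: ball_triangle uz (ball_sym xz).
have /cvg_ex[y xy] : cvg (x @ \oo) by exact: cauchy_cvg.
exists y => A B FA By; have FB := xy B By.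
by have [n [? ?]] := @filter_ex _ \oo _ _ (filterI FA FB); exists (x n).
Qed.

End polish.

Lemma standard_borel_analytic (R : realType) d (X : measurableType d) :
  standard_borel R X -> exists U : nat -> set X, analytic_space (range U).
Proof.
move=> [P [f [hP [D cD dD] [g gf fg] mf]]].
have [u Du] := countable_enumeration point cD.
have du : dense (range u).
  move=> O O0 oO; have [x [Ox Dx]] := dD O O0 oO; exists x.
  by split => //; exact: Du.
have [V bV] := polish_base du; have aV := polish_analytic du hP bV.
have fK (A : set P) : f @` (f @^-1` A) = A.
  rewrite eqEsubset; split=> [_ [x Ax <-] //|y Ay].
  by exists (g y); rewrite ?fg //= fg.
have Kf (A : set X) : f @^-1` (f @` A) = A.
  rewrite eqEsubset; split=> [x [y Ay /(can_inj gf) <-] //|x Ax].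
  by exists x.
exists (fun n => f @^-1` V n); split.
- move=> _ [n _ <-]; apply/mf; rewrite fK.
  by apply: sub_sigma_algebra; exact: bV.1.
- move=> A /mf fA; rewrite -(Kf A).
  apply: (@sigma_algebra_preimage _ _ f (range V)).
    by move=> _ [n _ <-]; apply: sub_sigma_algebra; exists n.
  move: fA; apply: smallest_sub; first exact: smallest_sigma_algebra.
  exact: base_open_sigma.
- move=> x y xy; have [|_ [n _ <-] HU] := base_separating bV hP (x := f x) (y := f y).
    by move/(can_inj gf).
  by exists (f @^-1` V n) => //; exists n.
- case: aV => C [h [cC hC eC]]; exists C, (g \o h); split => //.
  + move=> s _ Cs [k _ <-]; have [n Hn] := hC s (V k) Cs (ex_intro2 _ _ k I erefl).
    by exists n => t Ct st; rewrite /= !fg; exact: Hn.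
  + rewrite -image_comp eC eqEsubset; split=> // x _.
    by exists (f x) => //; exact: gf.
Qed.

Lemma analytic_space_diag d (X : measurableType d) (U : nat -> set X) :
  analytic_space (range U) -> measurable [set p : X * X | p.1 = p.2].
Proof.
move=> [mU _ sU _]; have mUn n : measurable (U n) by apply: mU; exists n.
rewrite (_ : [set _ | _] =
  \bigcap_n ((U n `*` U n) `|` (~` U n `*` ~` U n))).
  apply: bigcap_measurable => [|n _]; first by exists 0%N.
  by apply: measurableU; apply: measurableX => //; exact: measurableC.
rewrite eqEsubset; split=> [[x y] /= -> n _|[x y] /= H].
  by have [] := pselect (U n y); [left|right].
apply: contrapT => /sU[_ [n _ <-] xy].
by have [[/= ? ?]|[/= ? ?]] := H n I; case: xy => -[].
Qed.

Section lc_group.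
Context (G : topologicalGroupType).
Hypotheses (lcG : locally_compact [set: G]) (hG : hausdorff_space G).
Context (V : nat -> set G) (bV : base_seq V).

Lemma group_regular : regular_space G.
Proof.
move=> x; have [B] := @lcG x I; rewrite withinET => Bx [cB clB].
exact: (compact_regular hG cB).
Qed.

Lemma compact_exhaustion : exists K : nat -> set G,
  (forall i, compact (K i)) /\ forall x, exists i, K i x.
Proof.
exists (fun i => if `[< compact (closure (V i)) >] then closure (V i) else set0).
split=> [i|x]; first by case: asboolP => // _; exact: compact0.
have [B] := @lcG x I; rewrite withinET => Bx [cB clB].
have [n [Vx VB]] := bV.2 x _ (open_interior B) Bx.
exists n; case: asboolP => [_|[]]; first exact: subset_closure.
apply: (subclosed_compact _ cB); first exact: closed_closure.
rewrite (closure_id B).1 //; apply: closureS.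
exact: subset_trans VB (@interior_subset _ _).
Qed.

Lemma open_borel (U : set G) : open U -> measurable (U : set (borel_group G)).
Proof. by move=> oU; exact: sub_sigma_algebra. Qed.

Lemma closed_borel (U : set G) : closed U -> measurable (U : set (borel_group G)).
Proof.
by move=> cU; rewrite -(setCK U); apply: measurableC; apply: open_borel; exact: closed_openC.
Qed.

Lemma group_analytic : @analytic_space _ (borel_group G) (range V).
Proof.
have [K [cK covK]] := compact_exhaustion; split.
- by move=> _ [n _ <-]; apply: open_borel; exact: bV.1.
- apply: smallest_sub; first exact: smallest_sigma_algebra.
  exact: base_open_sigma.
- exact: base_separating bV hG.
- apply: (@base_analytic _ 1%g V (fun _ => K)) => //.
  + exact: group_regular.
  + by move=> _ i; exact: compact_closed.
  + move=> s x Hx; have [|y [_ yx]] := cK (s 0%N) (x @ \oo) _.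
      by exists 1%N => // n /= n0; exact: Hx n0.
    by exists y.
Qed.

(** Otherwise points of [K] outside the first [N] sets, one for each [N], would
    accumulate at a point of [K] that none of the sets contains. *)
Lemma compact_cover_seq (K : set G) (W : nat -> set G) : compact K ->
  (forall n, open (W n)) -> (forall g, K g -> exists n, W n g) ->
  exists N, forall g, K g -> exists2 n, (n < N)%N & W n g.
Proof.
move=> cK oW KW; apply: contrapT => /forallNP nW.
have /choice[x Hx] : forall N, exists g, K g /\ forall n, (n < N)%N -> ~ W n g.
  move=> N; have /existsNP[g /not_implyP[Kg Wg]] := nW N.
  by exists g; split=> // n nN Wn; apply: Wg; exists n.
have [|y [Ky xy]] := cK (x @ \oo) _; first by exists 0%N => // n _; exact: (Hx n).1.
have [n Wy] := KW y Ky.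
have : (~` W n) y.
  apply: (@cluster_closed _ x _ _ n.+1 _ _ xy).
    exact: open_closedC.
  by move=> N nN; exact: (Hx N).2.
exact.
Qed.

Context d (X : measurableType d) (E : set (set X)) (aE : analytic_space E).
Let EG := prod_family (range V) E.
Let aEG : @analytic_space _ (borel_group G * X)%type EG.
Proof. exact: analytic_space_prod group_analytic aE. Qed.

(** The complement of [B] has open sections; Novikov's theorem writes it as a
    countable union of measurable rectangles [V n `*` M n] up to points outside
    [K]. By compactness the section of [B] over [x] is empty exactly when
    finitely many of the [V n] with [M n x] cover [K], which is a measurable
    condition on [x]. *)
Lemma measurable_proj_compact (K : set G) (B : set (borel_group G * X)) :
  compact K -> measurable B ->
  (forall x, closed ([set g | B (g, x)] : set G)) ->
  measurable [set x | exists2 g, K g & B (g, x)].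
Proof.
move=> cK mB clB.
have mK : measurable (K : set (borel_group G)).
  by apply: closed_borel; exact: compact_closed.
have fstm (A : set (borel_group G)) : measurable A ->
    measurable (fst @^-1` A : set (borel_group G * X)).
  by move=> mA; rewrite -[X in measurable X]setTI; exact: measurable_fst.
have mV n : measurable (V n : set (borel_group G)).
  by apply: open_borel; exact: bV.1.
pose A := (fst @^-1` K `&` ~` B : set (borel_group G * X)).
have mA : measurable A.
  by apply: measurableI; [exact: fstm|exact: measurableC].
pose Q n := snd @` (fst @^-1` V n `&` B).
have aQ n : analytic E (Q n).
  apply: (@analytic_proj _ _ (range V)).
  apply: (analytic_space_measurable aEG).
  by apply: measurableI => //; exact: fstm.
(* as the sections of [A] are open in [K], the rectangles [V n `*` ~` Q n] cover
   [A]; [Z n] is the part of [A] outside the [n]-th one *)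
pose Z n : set (borel_group G * X) := A `&` (~` (fst @^-1` V n) `|` snd @^-1` (Q n)).
have aZ n : analytic EG (Z n).
  have sG := analytic_separating aEG.
  apply: analyticI => //; first exact: (analytic_space_measurable aEG).
  apply: analyticU.
    by apply: (analytic_space_measurable aEG); apply: measurableC; exact: fstm.
  by rewrite -setTX; apply: analytic_setX => //; case: group_analytic.
have Z0 : \bigcap_n Z n = set0.
  rewrite -subset0 => -[g x] Zx.
  have [[Kg nB] _] := Zx 0%N I.
  have oB : open (~` [set g | B (g, x)] : set G) by exact: closed_openC.
  have [n [Vg VB]] := bV.2 g _ oB nB.
  have [_ [|[[h y] [/= Vh Bh] e]]] := Zx n I; first exact.
  by apply: (VB h Vh); rewrite -e.
have [C [mC ZC C0]] := novikov_separation (analytic_measurable aEG)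
  (analytic_separating aEG) aZ Z0.
pose D n := A `&` ~` C n.
have DQ n : (snd @` D n) `&` Q n = set0.
  rewrite -subset0 => _ [[[g x] [Ax nC] <-] Qx]; apply: nC; apply: ZC.
  by split=> //; right.
have /choice[M HM] : forall n, exists M : set X,
    [/\ measurable M, snd @` D n `<=` M & M `&` Q n = set0].
  move=> n; have [|M mM [DM MQ]] := lusin_separation (analytic_measurable aE)
    (analytic_separating aE) _ (aQ n) (DQ n); last by exists M.
  apply: (@analytic_proj _ _ (range V)); apply: (analytic_space_measurable aEG).
  by apply: measurableI => //; exact: measurableC.
rewrite (_ : [set x | _] = ~` \bigcup_(l : seq nat)
  (if `[< forall g, K g -> exists2 n, n \in l & V n g >] then
   \bigcap_n (if n \in l then M n else setT) else set0)).
  apply: measurableC; apply: countable_bigcupT_measurable => //.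
  move=> l; case: asboolP => // _; apply: bigcap_measurable => [|n _].
    by exists 0%N.
  by case: ifP => // _; have [] := HM n.
rewrite eqEsubset; split=> x.
  move=> [g Kg Bg] [l _]; case: asboolP => // Kl Mx.
  have [n nl Vg] := Kl g Kg; have [_ _ MQ] := HM n.
  suff : (M n `&` Q n) x by rewrite MQ.
  split; first by have := Mx n I; rewrite nl.
  by exists (g, x).
apply: contra_notP => /forall2NP nB.
have nB' g : K g -> ~ B (g, x) by case: (nB g).
have [||N HN] := @compact_cover_seq K (fun n => if `[< M n x >] then V n else set0) cK.
- by move=> n; case: asboolP => // _; [exact: bV.1|exact: open0].
- move=> g Kg; apply: contrapT => /forallNP ng.
  suff : (\bigcap_n C n) (g, x) by rewrite C0.
  move=> n _; apply: contrapT => nC.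
  have Dg : D n (g, x) by split=> //; split=> //; exact: nB'.
  have [mM DM MQ] := HM n.
  have Mx : M n x by apply: DM; exists (g, x).
  apply: (ng n); case: asboolP => // _.
  apply: contrapT => Vg; apply: nC; apply: ZC; split=> //; first by case: Dg.
  by left.
exists [seq n <- iota 0 N | `[< M n x >]] => //.
case: asboolP => [_ n _|[]].
  by rewrite mem_filter; case: asboolP => //= Mx; case: ifP.
move=> g Kg; have [n nN] := HN g Kg; case: asboolP => // Mx Vg.
by exists n => //; rewrite mem_filter mem_iota /= add0n nN andbT; exact/asboolP.
Qed.

End lc_group.

(** * Borel enumeration of the return sets *)

Section borel_group_operations.
Context (G : topologicalGroupType) (V : nat -> set G) (bV : base_seq V).

Lemma continuous_borel (f : G -> G) : continuous f ->
  measurable_fun [set: borel_group G] (f : borel_group G -> borel_group G).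
Proof.
move=> cf; apply: (@measurability _ _ _ (borel_group G) setT _ (@open G)) => // _ [U oU <-].
by rewrite setTI; apply: open_borel; move/continuousP: cf; exact.
Qed.

Lemma open_prod_borel (U : set (G * G)) : open U ->
  measurable (U : set (borel_group G * borel_group G)).
Proof.
move=> oU.
pose W i j := if `[< V i `*` V j `<=` U >] then V i `*` V j else set0.
rewrite (_ : U = \bigcup_i \bigcup_j W i j).
  apply: bigcup_measurable => i _; apply: bigcup_measurable => j _.
  rewrite /W; case: asboolP => // _.
  by apply: measurableX; apply: open_borel; exact: bV.1.
rewrite eqEsubset; split=> [[g h] Ugh|[g h] [i _ [j _]]]; last first.
  by rewrite /W; case: asboolP => // ijU ?; exact: ijU.
have [[A B] /= [Ag Bh] ABU] := open_nbhs_nbhs (conj oU Ugh).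
have [i [Vi ViA]] := bV.2 g _ (open_interior A) Ag.
have [j [Vj VjB]] := bV.2 h _ (open_interior B) Bh.
exists i => //; exists j => //; rewrite /W; case: asboolP => // -[].
move=> [a b] [/= Va Vb]; apply: ABU; split => /=.
  by apply: interior_subset; exact: ViA.
by apply: interior_subset; exact: VjB.
Qed.

Lemma measurable_mulg : measurable_fun [set: borel_group G * borel_group G]
  (fun p => (p.1 * p.2)%g : borel_group G).
Proof.
apply: (@measurability _ _ _ (borel_group G) setT _ (@open G)) => // _ [U oU <-]; rewrite setTI.
apply: open_prod_borel.
by have /continuousP := @mulg_continuous G; exact.
Qed.

Lemma measurable_invg : measurable_fun [set: borel_group G]
  (fun g => g^-1%g : borel_group G).
Proof. exact: continuous_borel (@invg_continuous G). Qed.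

Lemma measurable_diag : hausdorff_space G ->
  measurable [set p : borel_group G * borel_group G | p.1 = p.2].
Proof.
move=> hG.
rewrite (_ : [set _ | _] = (fun p : borel_group G * borel_group G =>
   (p.1 * p.2^-1)%g : borel_group G) @^-1` [set 1%g]).
  rewrite -[X in measurable X]setTI.
  apply: (measurable_comp (F := setT)
    (f := fun p : borel_group G * borel_group G => (p.1 * p.2)%g : borel_group G)
    (g := fun p : borel_group G * borel_group G => (p.1, p.2^-1%g))) => //.
  - exact: measurable_mulg.
  - apply: measurable_fun_pair; first exact: measurable_fst.
    by apply: measurableT_comp; [exact: measurable_invg|exact: measurable_snd].
  - apply: closed_borel; apply: accessible_closed_set1.
    exact: hausdorff_accessible.
rewrite eqEsubset; split=> [[g h] /= ->|[g h] /= gh]; first by rewrite mulgV.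
by apply: (mulIg h^-1%g); rewrite gh mulgV.
Qed.

End borel_group_operations.

(** The countably many Borel sections of Lusin and Novikov, as partial functions
    [gam n] with domain [D n], extended to all of [X]. *)
Record enumeration (G : topologicalGroupType) d (X : measurableType d)
    (act : G -> X -> X) (Y : set X) (D : nat -> set X)
    (gam : nat -> X -> borel_group G) : Prop := {
  enum_dom : forall n, measurable (D n) ;
  enum_fun : forall n, measurable_fun setT (gam n) ;
  enum_in : forall n x, D n x -> Y (act (gam n x) x) ;
  enum_surj : forall x g, Y (act g x) -> exists2 n, D n x & gam n x = g ;
  enum_inj : forall x i j, D i x -> D j x -> gam i x = gam j x -> i = j }.

Section enumeration.
Context (G : topologicalGroupType).
Hypotheses (lcG : locally_compact [set: G]) (hG : hausdorff_space G).
Context (V : nat -> set G) (bV : base_seq V).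
Context d (X : measurableType d) (E : set (set X)) (aE : analytic_space E).
Context (act : G -> X -> X) (bact : borel_action act) (Y : cross_section act).

Let Gam : set (borel_group G * X) := [set p | cs_set Y (act p.1 p.2)].

Let mGam : measurable Gam.
Proof.
rewrite -[X in measurable X]setTI.
by apply: (act_measurable bact) => //; exact: cs_measurable.
Qed.

Let cylinder (A : set (borel_group G)) : measurable A ->
  measurable (fst @^-1` A : set (borel_group G * X)).
Proof. by move=> mA; rewrite -[X in measurable X]setTI; exact: measurable_fst. Qed.

Lemma measurable_proj_return (B : set (borel_group G * X)) : measurable B ->
  B `<=` Gam -> measurable [set x | exists g, B (g, x)].
Proof.
move=> mB BGam; have [K [cK covK]] := compact_exhaustion lcG bV.
have mK i : measurable (K i : set (borel_group G)).
  by apply: closed_borel; exact: compact_closed.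
rewrite (_ : [set _ | _] =
  \bigcup_i [set x | exists2 g, K i g & (B `&` fst @^-1` K i) (g, x)]).
  apply: bigcup_measurable => i _.
  apply: (measurable_proj_compact lcG hG bV aE) => //.
    by apply: measurableI => //; exact: cylinder.
  move=> x; apply: (accessible_finite_set_closed.1 (hausdorff_accessible hG)).
  apply: sub_finite_set (cs_locally_finite Y x (cK i)).
  by move=> g [/= Bg Kg]; split => //; exact: BGam Bg.
rewrite eqEsubset; split=> [x [g Bg]|x [i _ [g _ [Bg _]]]]; last by exists g.
by have [i Kg] := covK g; exists i => //; exists g.
Qed.

(** Near each of its points a return set has no other point; so it is the union
    over the basic open sets [V n] of its parts in those [V n] that contain only
    one of its points. *)
Lemma return_set_enumeration : exists D gam,
  enumeration act (cs_set Y) D gam.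
Proof.
have mV n : measurable (V n : set (borel_group G)).
  by apply: open_borel; exact: bV.1.
pose many n := [set x | exists g h, [/\ V n g, V n h, g <> h, Gam (g, x) & Gam (h, x)]].
pose hit i n := [set x | exists g : borel_group G,
  (Gam `&` fst @^-1` (V i `&` V n)) (g, x)].
have mhit i n : measurable (hit i n).
  apply: measurable_proj_return; last by move=> p [].
  by apply: measurableI => //; apply: cylinder; exact: measurableI.
have mmany n : measurable (many n).
  rewrite (_ : many n = \bigcup_i \bigcup_j
      (if `[< V i `&` V j = set0 >] then hit i n `&` hit j n else set0)).
    apply: bigcup_measurable => i _; apply: bigcup_measurable => j _.
    by case: asboolP => // _; exact: measurableI.
  rewrite eqEsubset; split=> x.
    move=> [g [h [Vg Vh /eqP gh Gg Gh]]].
    move: hG; rewrite open_hausdorff => /(_ _ _ gh)[[A B] /= [+ +] [oA oB /eqP AB]].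
    rewrite !inE => Ag Bh.
    have [i [Vig ViA]] := bV.2 g A oA Ag; have [j [Vjh VjB]] := bV.2 h B oB Bh.
    exists i => //; exists j => //; case: asboolP => [_|[]].
      by split; [exists g|exists h].
    by rewrite -subset0 -AB => k [/ViA Ak /VjB Bk].
  move=> [i _ [j _]]; case: asboolP => // ij [[g [Gg [Vig Vng]]] [h [Gh [Vjh Vnh]]]].
  exists g, h; split => // e; suff : (V i `&` V j) g by rewrite ij.
  by split => //; rewrite e.
pose P n : set (borel_group G * X) := Gam `&` fst @^-1` V n `&` snd @^-1` (~` many n).
have mP n : measurable (P n).
  apply: measurableI; first by apply: measurableI => //; exact: cylinder.
  rewrite -[X in measurable X]setTI; apply: measurable_snd => //.
  exact: measurableC.
pose Q := seqDU P.
have mQ n : measurable (Q n) by exact: seqDU_measurable.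
have QP n : Q n `<=` P n by exact: subset_seqDU.
have Q1 n x g h : Q n (g, x) -> Q n (h, x) -> g = h.
  move=> /QP[[Gg Vg] /= nm] /QP[[Gh Vh] _].
  by apply: contrapT => gh; apply: nm; exists g, h.
have GamP : Gam `<=` \bigcup_n P n.
  move=> [g x] Gg; have [C] := @lcG g I; rewrite withinET => Cg [cC clC].
  pose F := (return_set act (cs_set Y) x `&` C) `\ g.
  have finF : finite_set F by apply: finite_setD; exact: cs_locally_finite.
  have oF : open (~` F).
    apply: closed_openC.
    exact: (accessible_finite_set_closed.1 (hausdorff_accessible hG)).
  have [n [Vg VF]] : exists n, V n g /\ V n `<=` C^° `&` ~` F.
    apply: bV.2; first by apply: openI => //; exact: open_interior.
    by split => // -[_]; apply.
  exists n => //; split; first by split.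
  move=> [h [k [Vh Vk hk Gh Gk]]].
  have onlyg a : V n a -> Gam (a, x) -> a = g.
    move=> Va Ga; apply: contrapT => ag; have [Ca] := VF _ Va; apply.
    by split => //; split => //; exact: interior_subset.
  by apply: hk; rewrite (onlyg h)// (onlyg k).
pose D n := [set x | exists g : borel_group G, Q n (g, x)].
pose gam n x : borel_group G := xget 1%g [set g : borel_group G | Q n (g, x)].
have gamQ n x : D n x -> Q n (gam n x, x).
  by move=> Dx; exact: (xgetPex 1%g Dx).
exists D, gam; split.
- move=> n; apply: measurable_proj_return => // p Qp.
  by have [[]] := QP _ _ Qp.
- move=> n _ A mA; rewrite setTI.
  rewrite (_ : gam n @^-1` A = [set x | exists g, (Q n `&` fst @^-1` A) (g, x)] `|`
      (if `[< A 1%g >] then ~` D n else set0)).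
    apply: measurableU.
      apply: measurable_proj_return; first by apply: measurableI => //; exact: cylinder.
      by move=> p [Qp _]; have [[]] := QP _ _ Qp.
    case: asboolP => // _; apply: measurableC; apply: measurable_proj_return => //.
    by move=> p Qp; have [[]] := QP _ _ Qp.
  have gam1 x : ~ D n x -> gam n x = 1%g.
    by move=> nD; apply: xgetPN => g Qg; apply: nD; exists g.
  rewrite eqEsubset; split=> x /=.
    have [Dx|nDx] := pselect (D n x); last first.
      by rewrite gam1 // => A1; right; case: asboolP.
    by move=> Ax; left; exists (gam n x); split => //; exact: gamQ.
  case=> [[g [Qg Ag]]|]; last by case: asboolP => // A1 /gam1 ->.
  by rewrite (_ : gam n x = g) //; apply: (Q1 n x) => //; apply: gamQ; exists g.
- by move=> n x /gamQ/QP[[]].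
- move=> x g Gg; have : (\bigcup_n Q n) (g, x).
    by rewrite -seqDU_bigcup_eq; exact: GamP.
  move=> [n _ Qg]; have Dx : D n x by exists g.
  by exists n => //; apply: (Q1 n x) => //; exact: gamQ.
- move=> x i j /gamQ Qi /gamQ Qj e.
  apply: (@trivIset_seqDU _ P i j) => //; exists (gam i x, x); split => //.
  by rewrite e.
Qed.

End enumeration.

(** * Measures *)

Local Open Scope ereal_scope.

Lemma ge0_integral_mrestr d (T : measurableType d) (R : realType)
    (mu : {measure set T -> \bar R}) (D : set T) (mD : measurable D)
    (f : T -> \bar R) : measurable_fun setT f -> (forall x, 0 <= f x) ->
  \int[mrestr mu mD]_x f x = \int[mu]_x (f x * (\1_D x)%:E).
Proof.
move=> mf f0; have mDc := measurableC mD.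
rewrite -[X in integral _ X](setUv D) (ge0_integral_setU _ mD mDc) //; last 2 first.
- exact: measurable_funTS.
- exact/disj_setPCl.
rewrite [X in _ + X]null_set_integral //; last 2 first.
- exact: measurable_funTS.
- by rewrite /= /mrestr setICl measure0.
rewrite adde0.
transitivity (\int[mu]_(x in D) f x).
  by apply: eq_measure_integral => A mA AD; rewrite /= /mrestr (setIidl AD).
by rewrite integral_mkcond epatch_indic.
Qed.

(** Every measure constructed below is of this form up to countable sums and
    scaling. *)
Lemma restr_pushforward d d' (T : measurableType d) (U : measurableType d')
    (R : realType) (mu : {measure set T -> \bar R}) (D : set T) (s : T -> U) :
  measurable D -> measurable_fun setT s ->
  exists nu : {measure set U -> \bar R}, forall f : U -> \bar R,
    measurable_fun setT f -> (forall y, 0 <= f y) ->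
    \int[nu]_y f y = \int[mu]_x (f (s x) * (\1_D x)%:E).
Proof.
move=> mD ms; unshelve eexists (pushforward (mrestr mu mD) s); first exact: ms.
move=> f mf f0.
rewrite (ge0_integral_pushforward ms) //=.
rewrite preimage_setT ge0_integral_mrestr //.
exact: measurableT_comp.
Qed.

(** Chebyshev's inequality: the sets where one of the [phi i] is at least a given
    positive number have finite measure, and they cover the space. *)
Lemma sigma_finite_integral d (T : measurableType d) (R : realType)
    (nu : {measure set T -> \bar R}) (I : countType) (phi : I -> T -> \bar R) :
  (forall i, measurable_fun setT (phi i)) -> (forall i y, 0 <= phi i y) ->
  (forall i, \int[nu]_y phi i y < +oo) -> (forall y, exists i, 0 < phi i y) ->
  sigma_finite setT nu.
Proof.
move=> mphi phi0 phioo phipos.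
pose A (p : I * nat) := [set y | (p.2.+1%:R^-1)%:E <= phi p.1 y].
have mA p : measurable (A p).
  by rewrite -[X in measurable X]setTI; exact: emeasurable_fun_c_infty.
exists (fun n => if unpickle n is Some p then A p else set0).
  rewrite eqEsubset; split=> // y _; have [i phiy] := phipos y.
  have [l Hl] : exists l : nat, (l.+1%:R^-1)%:E <= phi i y.
    case: (phi i y) phiy => [r| |//]; rewrite ?lte_fin => r0; last first.
      by exists 0%N; rewrite leey.
    have [l _ /(_ l (leqnn l)) /= Hl] := near_infty_natSinv_lt (PosNum r0).
    by exists l; rewrite lee_fin ltW.
  by exists (pickle (i, l)) => //; rewrite pickleK.
move=> n; case: unpickle => [p|]; last by rewrite measure0.
split=> //; have l0 : (0 < p.2.+1%:R^-1 :> R)%R by rewrite invr_gt0.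
have := le_integral_abse nu measurableT (mphi p.1) l0.
rewrite (_ : _ `&` _ = A p); last first.
  by rewrite setTI; apply/funext => y; rewrite /A /= gee0_abs.
under [X in _ <= X]eq_integral do rewrite gee0_abs //.
move=> /le_lt_trans /(_ (phioo p.1)).
case: (nu (A p)) => [r| |//]; first by move=> _; rewrite ltry.
by rewrite gt0_muley // lte_fin.
Qed.

(** Replaces a measure by an equal one that carries the structure required by
    Tonelli's theorem. *)
Lemma sigma_finite_measureP d (T : measurableType d) (R : realType)
    (nu : {measure set T -> \bar R}) : sigma_finite setT nu ->
  exists nu' : {sigma_finite_measure set T -> \bar R},
    (nu' : {measure set T -> \bar R}) = nu.
Proof.
move=> sf.
pose H1 := isSFinite.Build _ _ _ (Measure.sort nu) (sfinite_measure_sigma_finite sf).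
pose H2 := isSigmaFinite.Build _ _ _ (Measure.sort nu) sf.
pose nu' : {sigma_finite_measure set T -> \bar R} :=
  HB.pack_for (SigmaFiniteMeasure.type T R) (Measure.sort nu) H1 H2.
by exists nu'; apply: eq_measure.
Qed.

Lemma measure_bigcup_null d (T : measurableType d) (R : realType)
    (mu : {measure set T -> \bar R}) (F : nat -> set T) :
  (forall n, measurable (F n)) -> (forall n, mu (F n) = 0) ->
  mu (\bigcup_n F n) = 0.
Proof.
move=> mF F0; apply/eqP; rewrite eq_le measure_ge0 andbT.
have := measure_sigma_subadditive mu mF (bigcupT_measurable F mF) (@subset_refl _ _).
by move=> /le_trans; apply; rewrite eseries0.
Qed.

Lemma ge0_integral_invariant d (T : measurableType d) (R : realType)
    (mu : {measure set T -> \bar R}) (s : T -> T) (f : T -> \bar R) :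
  measurable_fun setT s ->
  (forall A, measurable A -> pushforward mu s A = mu A) ->
  measurable_fun setT f -> (forall x, 0 <= f x) ->
  \int[mu]_x f (s x) = \int[mu]_x f x.
Proof.
move=> ms smu mf f0; transitivity (\int[pushforward mu s]_x f x).
  by rewrite (ge0_integral_pushforward ms).
by apply: eq_measure_integral => A mA _; exact: smu.
Qed.

Section measurable_operations.
Context (G : topologicalGroupType) (V : nat -> set G) (bV : base_seq V).
Context d (T : measurableType d) d' (X : measurableType d').

Lemma measurable_fun_mulg (f g : T -> borel_group G) :
  measurable_fun setT f -> measurable_fun setT g ->
  measurable_fun setT (fun t => (f t * g t)%g : borel_group G).
Proof.
move=> mf mg.
exact: measurableT_comp (measurable_mulg bV) (measurable_fun_pair mf mg).
Qed.

Lemma measurable_fun_invg (f : T -> borel_group G) :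
  measurable_fun setT f -> measurable_fun setT (fun t => (f t)^-1%g : borel_group G).
Proof. by move=> mf; exact: measurableT_comp (@measurable_invg G) mf. Qed.

Lemma measurable_fun_act (act : G -> X -> X) (f : T -> borel_group G) (g : T -> X) :
  borel_action act -> measurable_fun setT f -> measurable_fun setT g ->
  measurable_fun setT (fun t => act (f t) (g t)).
Proof.
move=> bact mf mg.
exact: measurableT_comp (act_measurable bact) (measurable_fun_pair mf mg).
Qed.

End measurable_operations.

(** * Haar measure *)

Section haar.
Context (R : realType) (G : topologicalGroupType) (V : nat -> set G).
Hypotheses (bV : base_seq V) (uG : unimodular R G).
Context (m : {sigma_finite_measure set (borel_group G) -> \bar R}).
Hypothesis haar_m : haar_measure m.
Implicit Type F : borel_group G -> \bar R.

Lemma haar_integral_left F (h : G) : measurable_fun setT F ->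
  (forall g, 0 <= F g) -> \int[m]_g F (h * g)%g = \int[m]_g F g.
Proof.
move=> mF F0.
apply: (@ge0_integral_invariant _ _ _ m (fun g : borel_group G => h * g)%g) => //.
  apply: (measurable_fun_mulg bV); [exact: measurable_cst|exact: measurable_id].
move=> A mA; rewrite -[RHS](haar_left_invariant haar_m h^-1%g mA).
congr (m _); rewrite eqEsubset; split=> [g Ag|_ [g Ag <-]] /=.
  by exists (h * g)%g => //; rewrite mulKg.
by rewrite mulVKg.
Qed.

Lemma haar_integral_right F (h : G) : measurable_fun setT F ->
  (forall g, 0 <= F g) -> \int[m]_g F (g * h)%g = \int[m]_g F g.
Proof.
move=> mF F0.
apply: (@ge0_integral_invariant _ _ _ m (fun g : borel_group G => g * h)%g) => //.
  apply: (measurable_fun_mulg bV); [exact: measurable_id|exact: measurable_cst].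
move=> A mA; rewrite -[RHS](uG haar_m h^-1%g mA).
congr (m _); rewrite eqEsubset; split=> [g Ag|_ [g Ag <-]] /=.
  by exists (g * h)%g => //; rewrite mulgK.
by rewrite mulgVK.
Qed.

(** With [x] and [y] ranging over the group, invariance on both sides gives
    [(\int w(x)) (\int F(y^-1)) = \int\int w(yx) F(y^-1) = \int\int w(y) F(x y^-1)
     = (\int w(y)) (\int F(x))], and the integral of [w] is 1. *)
Lemma haar_integral_inv w F : transverse_weight m w -> measurable_fun setT F ->
  (forall g, 0 <= F g) -> \int[m]_g F (g^-1)%g = \int[m]_g F g.
Proof.
move=> [mw w0 w1] mF F0.
have mFV : measurable_fun setT (fun g : borel_group G => F (g^-1)%g).
  by apply: measurableT_comp mF _; exact: measurable_invg.
rewrite -[LHS]mul1e -w1.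
transitivity (\int[m]_y \int[m]_x (w (y * x)%g * F (y^-1)%g)).
  rewrite muleC -ge0_integralZr //; last exact: integral_ge0.
  apply: eq_integral => y _; rewrite muleC.
  rewrite ge0_integralZr //; first by rewrite haar_integral_left.
  by apply: measurableT_comp mw _; apply: (measurable_fun_mulg bV).
rewrite (fubini_tonelli (fun p : borel_group G * borel_group G =>
   w (p.1 * p.2)%g * F (p.1^-1)%g)); last 2 first.
- apply: emeasurable_funM.
    by apply: measurableT_comp mw _; exact: measurable_mulg bV.
  apply: measurableT_comp mF _; apply: measurable_fun_invg; exact: measurable_fst.
- by move=> p; exact: mule_ge0.
transitivity (\int[m]_x \int[m]_y (w y * F (x * y^-1)%g)).
  apply: eq_integral => x _ /=.
  rewrite -(@haar_integral_right (fun y => w y * F (x * y^-1)%g) x); last 2 first.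
  - apply: emeasurable_funM => //; apply: measurableT_comp mF _.
    apply: (measurable_fun_mulg bV) => //; exact: measurable_invg.
  - by move=> y; exact: mule_ge0.
  by apply: eq_integral => y _; rewrite invgM mulVKg.
rewrite -(fubini_tonelli (fun p : borel_group G * borel_group G =>
   w p.1 * F (p.2 * p.1^-1)%g)); last 2 first.
- apply: emeasurable_funM; first by apply: measurableT_comp mw _; exact: measurable_fst.
  apply: measurableT_comp mF _; apply: (measurable_fun_mulg bV).
    exact: measurable_snd.
  apply: measurable_fun_invg; exact: measurable_fst.
- by move=> p; exact: mule_ge0.
transitivity (\int[m]_y (w y * \int[m]_g F g)).
  apply: eq_integral => y _ /=; rewrite ge0_integralZl //.
    by rewrite haar_integral_right.
  by apply: measurableT_comp mF _; apply: (measurable_fun_mulg bV).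
rewrite ge0_integralZr //; last exact: integral_ge0.
by rewrite w1 mul1e.
Qed.

End haar.

(** * Sums over return sets *)

Section orbit_sum.
Context (R : realType) (G : topologicalGroupType) (V : nat -> set G).
Hypothesis bV : base_seq V.
Context d (X : measurableType d) (act : G -> X -> X) (bact : borel_action act).
Context (Y : set X) (D : nat -> set X) (gam : nat -> X -> borel_group G).
Hypothesis en : enumeration act Y D gam.
Implicit Type F : borel_group G * X -> \bar R.

Definition orbit_sum F (x : X) : \bar R :=
  \esum_(g in return_set act Y x) F (g, act g x).

Lemma esum_enumeration x (a : borel_group G -> \bar R) : (forall g, 0 <= a g) ->
  \esum_(g in return_set act Y x) a g =
  \sum_(n <oo) (a (gam n x) * (\1_(D n) x)%:E).
Proof.
move=> a0; rewrite nneseries_esumT; last by move=> n; exact: mule_ge0.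
rewrite (@reindex_esum _ _ _ [set n | D n x] _ (gam^~ x)).
  rewrite esum_mkcond; apply: eq_esum => n _; rewrite indicE.
  rewrite (_ : (n \in _) = (x \in D n)); last by apply/idP/idP; rewrite !inE.
  by case: ifP => _; rewrite ?mule1 ?mule0.
split.
- by move=> n Dx; exact: enum_in en _ _ Dx.
- move=> i j; rewrite !inE => Di Dj e; exact: enum_inj en _ _ _ Di Dj e.
- by move=> g Yg; have [n Dx <-] := enum_surj en Yg; exists n.
Qed.

Lemma orbit_sum_ge0 F x : (forall p, 0 <= F p) -> 0 <= orbit_sum F x.
Proof. by move=> F0; exact: esum_ge0. Qed.

Lemma measurable_enum_pair n :
  measurable_fun setT (fun x => (gam n x, act (gam n x) x)).
Proof.
apply: measurable_fun_pair; first exact: enum_fun en n.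
by apply: (measurable_fun_act bact) => //; exact: enum_fun en n.
Qed.

Lemma measurable_orbit_sum_param d' (T : measurableType d')
    (F : T * (borel_group G * X) -> \bar R) :
  measurable_fun setT F -> (forall p, 0 <= F p) ->
  measurable_fun setT (fun p : T * X => orbit_sum (fun q => F (p.1, q)) p.2).
Proof.
move=> mF F0.
rewrite (_ : (fun p => _) = fun p : T * X => \sum_(n <oo)
  (F (p.1, (gam n p.2, act (gam n p.2) p.2)) * (\1_(D n) p.2)%:E)).
  apply: ge0_emeasurable_sum => [n p _ _|n _]; first exact: mule_ge0.
  apply: emeasurable_funM.
    apply: measurableT_comp mF _; apply: measurable_fun_pair => //.
    exact: measurableT_comp (measurable_enum_pair n) measurable_snd.
  apply/measurable_EFinP; apply: measurableT_comp measurable_snd.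
  by apply: measurable_indic; exact: enum_dom en n.
apply/funext => p; rewrite /orbit_sum.
by rewrite (@esum_enumeration p.2 (fun g => F (p.1, (g, act g p.2)))).
Qed.

Lemma measurable_orbit_sum F : measurable_fun setT F -> (forall p, 0 <= F p) ->
  measurable_fun setT (orbit_sum F).
Proof.
move=> mF F0.
have mF' : measurable_fun setT (fun p : X * (borel_group G * X) => F p.2).
  exact: measurableT_comp mF measurable_snd.
have H := measurable_orbit_sum_param mF' (fun p => F0 p.2).
apply: (measurableT_comp (g := fun x : X => (x, x)) H).
exact: measurable_fun_pair (@measurable_id _ _ _) (@measurable_id _ _ _).
Qed.

Lemma integral_orbit_sum d' (T : measurableType d')
    (m : {measure set T -> \bar R}) (F : T * (borel_group G * X) -> \bar R) x :
  measurable_fun setT F -> (forall p, 0 <= F p) ->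
  \int[m]_t orbit_sum (fun q => F (t, q)) x =
  orbit_sum (fun q => \int[m]_t F (t, q)) x.
Proof.
move=> mF F0.
rewrite /orbit_sum (@esum_enumeration x (fun g => \int[m]_t F (t, (g, act g x)))); last first.
  by move=> g; exact: integral_ge0.
under eq_integral => t _ do
  rewrite (@esum_enumeration x (fun g => F (t, (g, act g x)))) //.
have mFx n : measurable_fun setT (fun t => F (t, (gam n x, act (gam n x) x))).
  apply: measurableT_comp mF _; apply: measurable_fun_pair => //.
rewrite integral_nneseries //; last 2 first.
- by move=> n; apply: emeasurable_funM.
- by move=> n t _; exact: mule_ge0.
apply: eq_eseriesr => n _; rewrite ge0_integralZr //.
Qed.

(** The return set of [hx] is the right translate by [h^-1] of that of [x]. *)
Lemma orbit_sum_act F h x :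
  orbit_sum F (act h x) = orbit_sum (fun p => F ((p.1 * h^-1)%g, p.2)) x.
Proof.
rewrite /orbit_sum (@reindex_esum _ _ _ (return_set act Y x) _ (fun g => (g * h^-1)%g)).
  by apply: eq_esum => g _ /=; rewrite -(act_mul bact) mulgVK.
split.
- by move=> g; rewrite /return_set /= -(act_mul bact) mulgVK.
- by move=> g g' _ _; exact: mulIg.
- move=> g; rewrite /return_set /= -(act_mul bact) => Yg.
  by exists (g * h)%g => //; rewrite mulgK.
Qed.

(** The Campbell measure of the return sets, seen as a point process on [G] over
    [mu]. It is the sum over [n] of the images of [mu], restricted to [D n], under
    the enumerating functions. *)
Lemma campbell_measure (mu : {measure set X -> \bar R}) :
  exists kappa : {measure set (borel_group G * X) -> \bar R},
    forall F, measurable_fun setT F -> (forall p, 0 <= F p) ->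
      \int[kappa]_p F p = \int[mu]_x orbit_sum F x.
Proof.
have /choice[kap Hkap] := fun n =>
  restr_pushforward mu (enum_dom en n) (measurable_enum_pair n).
exists (mseries kap 0) => F mF F0.
rewrite ge0_integral_measure_series //.
under eq_eseriesr => n _ do rewrite Hkap //.
rewrite -integral_nneseries //; last 2 first.
- move=> n; apply: emeasurable_funM.
    exact: measurableT_comp mF (measurable_enum_pair n).
  by apply/measurable_EFinP; apply: measurable_indic; exact: enum_dom en n.
- by move=> n x _; exact: mule_ge0.
apply: eq_integral => x _; rewrite /orbit_sum.
by rewrite (@esum_enumeration x (fun g => F (g, act g x))).
Qed.

End orbit_sum.

(** * Transverse measures *)

Section cross_section_space.
Context (R : realType) (G : topologicalGroupType) d (X : measurableType d).
Context (act : G -> X -> X) (Y : cross_section act).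

Lemma cs_valP (y : Y) : cs_set Y (cs_val y).
Proof. exact: set_valP. Qed.

Lemma measurable_cs_val : measurable_fun setT (@cs_val _ _ _ _ Y).
Proof. by move=> _ A mA; exists A. Qed.

Definition cs_retract (x : X) : Y :=
  if pselect (cs_set Y x) is left Yx then exist _ x (mem_set Yx) : Y
  else (point : pointed_cs Y).

Lemma cs_retractK x : cs_set Y x -> cs_val (cs_retract x) = x.
Proof. by rewrite /cs_retract; case: pselect. Qed.

Lemma cs_val_inj : injective (@cs_val _ _ _ _ Y).
Proof. exact: val_inj. Qed.

Lemma cs_valK (y : Y) : cs_retract (cs_val y) = y.
Proof. by apply: cs_val_inj; rewrite cs_retractK //; exact: cs_valP. Qed.

Lemma measurable_cs_retract : measurable_fun setT cs_retract.
Proof.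
move=> _ _ [A mA <-]; rewrite !setTI.
rewrite (_ : _ @^-1` _ = (cs_set Y `&` A) `|`
   (if `[< A (cs_val (point : pointed_cs Y)) >] then ~` cs_set Y else set0)).
  apply: measurableU; first by apply: measurableI => //; exact: cs_measurable.
  by case: asboolP => // _; apply: measurableC; exact: cs_measurable.
rewrite eqEsubset; split=> x /=.
  have [Yx|Yx] := pselect (cs_set Y x).
    by rewrite cs_retractK //; left.
  rewrite /cs_retract; case: pselect => // _ Ap; right.
  by case: asboolP.
case=> [[Yx Ax]|]; first by rewrite cs_retractK.
by case: asboolP => // Ap Yx; rewrite /cs_retract; case: pselect.
Qed.

Lemma cs_extend_val (f : Y -> \bar R) y : cs_extend f (cs_val y) = f y.
Proof. exact: (congr1 (fun h => h y) (valLK (0 : \bar R) f)). Qed.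

Lemma cs_extendE (f : Y -> \bar R) x : cs_set Y x ->
  cs_extend f x = f (cs_retract x).
Proof. by move=> Yx; rewrite -{1}(cs_retractK Yx) cs_extend_val. Qed.

End cross_section_space.

Section mecke.
Context (R : realType) (G : topologicalGroupType).
Context (m : {sigma_finite_measure set (borel_group G) -> \bar R}).
Context d (X : measurableType d) (act : G -> X -> X) (Y : cross_section act).
Implicit Types (mu : {measure set X -> \bar R}) (nu : {measure set Y -> \bar R}).
Implicit Type F : borel_group G * X -> \bar R.

(** The weight-free description of the transverse measure, known as the refined
    Campbell or Mecke formula for point processes. *)
Definition mecke mu nu : Prop :=
  forall F, measurable_fun setT F -> (forall p, 0 <= F p) ->
    \int[mu]_x orbit_sum act (cs_set Y) F x =
    \int[nu]_y \int[m]_g F (g, cs_val y).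

Lemma eq_orbit_sum F F' x : (forall g y, cs_set Y y -> F (g, y) = F' (g, y)) ->
  orbit_sum act (cs_set Y) F x = orbit_sum act (cs_set Y) F' x.
Proof. by move=> FF'; apply: eq_esum => g Yg; exact: FF'. Qed.

Lemma measurable_integral_haar F : measurable_fun setT F -> (forall p, 0 <= F p) ->
  measurable_fun setT (fun x => \int[m]_g F (g, x)).
Proof.
move=> mF F0; apply: (@measurable_fun_fubini_tonelli_F _ _ _ _ _ m (fun p => F (p.2, p.1))).
  apply: measurableT_comp mF _.
  exact: measurable_fun_pair measurable_snd measurable_fst.
by move=> p.
Qed.

Lemma mecke_transverse mu nu w : mecke mu nu -> transverse_weight m w ->
  is_transverse_measure w mu nu.
Proof.
move=> mk [mw w0 w1] f mf f0.
pose F (p : borel_group G * X) := f (cs_retract Y p.2) * w p.1.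
have mF : measurable_fun setT F.
  apply: emeasurable_funM; last exact: measurableT_comp mw measurable_fst.
  apply: measurableT_comp mf _.
  exact: measurableT_comp (@measurable_cs_retract _ _ _ _ Y) measurable_snd.
have F0 p : 0 <= F p by exact: mule_ge0.
rewrite /transverse_functional.
transitivity (\int[nu]_y \int[m]_g F (g, cs_val y)).
  apply: eq_integral => y _; rewrite /F /= cs_valK ge0_integralZl //.
  by rewrite w1 mule1.
rewrite -mk //; apply: eq_integral => x _.
by apply: eq_esum => g Yg; rewrite /F /= -cs_extendE.
Qed.


End mecke.

Section transverse_mecke.
Context (R : realType) (G : topologicalGroupType) (V : nat -> set G).
Hypotheses (bV : base_seq V) (uG : unimodular R G).
Context (m : {sigma_finite_measure set (borel_group G) -> \bar R}).
Hypothesis haar_m : haar_measure m.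
Context d (X : measurableType d) (act : G -> X -> X) (bact : borel_action act).
Context (Y : cross_section act) (D : nat -> set X) (gam : nat -> X -> borel_group G).
Hypothesis en : enumeration act (cs_set Y) D gam.
Implicit Types (mu : {sigma_finite_measure set X -> \bar R}).
Implicit Types (nu : {measure set Y -> \bar R}).
Implicit Type F : borel_group G * X -> \bar R.

Lemma measurable_act h : measurable_fun setT (act h).
Proof.
exact: (measurable_fun_act bact (f := fun=> h : borel_group G) (g := id)).
Qed.

Lemma orbit_sum_shift mu F (h : G) : action_invariant act mu ->
  measurable_fun setT F -> (forall p, 0 <= F p) ->
  \int[mu]_x orbit_sum act (cs_set Y) (fun p => F ((p.1 * h)%g, p.2)) x =
  \int[mu]_x orbit_sum act (cs_set Y) F x.
Proof.
move=> inv mF F0.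
have mFh : measurable_fun setT (fun p : borel_group G * X => F ((p.1 * h)%g, p.2)).
  apply: measurableT_comp mF _; apply: measurable_fun_pair; last exact: measurable_snd.
  by apply: (measurable_fun_mulg bV); [exact: measurable_fst|exact: measurable_cst].
rewrite -(@ge0_integral_invariant _ _ _ mu (act h)); last 4 first.
- exact: measurable_act.
- by move=> A mA; exact: inv.
- exact: (measurable_orbit_sum bact en).
- by move=> x; exact: orbit_sum_ge0.
apply: eq_integral => x _; rewrite (orbit_sum_act bact).
by apply: eq_esum => g _ /=; rewrite mulgVK.
Qed.

(** The sum [\int sum F(g, gx) dmu(x)] is invariant under right translation of
    [g] because [mu] is invariant; averaging over the group turns the weight [w]
    into the constant 1. *)
Lemma transverse_mecke mu nu w : action_invariant act mu ->
  transverse_weight m w -> is_transverse_measure w mu nu ->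
  mecke m mu nu.
Proof.
move=> inv hw tr F mF F0; have [mw w0 w1] := hw.
pose f x := \int[m]_g F (g, x).
have mf : measurable_fun setT f by exact: measurable_integral_haar.
have f0 x : 0 <= f x by exact: integral_ge0.
have mFx x : measurable_fun setT (fun g => F (g, x)).
  by apply: measurableT_comp mF _; exact: pair2_measurable.
have -> : \int[nu]_y \int[m]_g F (g, cs_val y) = \int[nu]_y (f \o @cs_val _ _ _ _ Y) y by [].
rewrite tr; last 2 first.
- by apply: measurableT_comp mf _; exact: measurable_cs_val.
- by move=> y; exact: f0.
(* [F1] and [F2] are exchanged by the right translation by the first variable;
   integrating it out gives [w * f] for the one and [F] for the other *)
pose F1 (p : borel_group G * (borel_group G * X)) :=
  w p.2.1 * F ((p.2.1 * p.1)%g, p.2.2).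
pose F2 (p : borel_group G * (borel_group G * X)) :=
  w (p.2.1 * p.1^-1)%g * F p.2.
have m21 : measurable_fun setT
    (fun p : borel_group G * (borel_group G * X) => p.2.1).
  exact: measurableT_comp measurable_fst measurable_snd.
have m22 : measurable_fun setT
    (fun p : borel_group G * (borel_group G * X) => p.2.2).
  exact: measurableT_comp measurable_snd measurable_snd.
have mF1 : measurable_fun setT F1.
  apply: emeasurable_funM; first exact: measurableT_comp mw m21.
  apply: measurableT_comp mF _; apply: measurable_fun_pair => //.
  exact: (measurable_fun_mulg bV m21 measurable_fst).
have F10 p : 0 <= F1 p by exact: mule_ge0.
have mF2 : measurable_fun setT F2.
  apply: emeasurable_funM; last exact: measurableT_comp mF measurable_snd.
  apply: measurableT_comp mw _; apply: (measurable_fun_mulg bV m21).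
  exact: measurable_fun_invg measurable_fst.
have F20 p : 0 <= F2 p by exact: mule_ge0.
have swap H : measurable_fun setT H -> (forall p, 0 <= H p) ->
    \int[mu]_x orbit_sum act (cs_set Y) (fun q => \int[m]_h H (h, q)) x =
    \int[m]_h \int[mu]_x orbit_sum act (cs_set Y) (fun q => H (h, q)) x.
  move=> mH H0.
  rewrite (fubini_tonelli (fun p : borel_group G * X =>
    orbit_sum act (cs_set Y) (fun q => H (p.1, q)) p.2)); last 2 first.
  - exact: (measurable_orbit_sum_param bact en).
  - by move=> p; exact: orbit_sum_ge0.
  apply: eq_integral => x _.
  by rewrite (integral_orbit_sum en).
have hF1 q : w q.1 * f q.2 = \int[m]_h F1 (h, q).
  rewrite /f -(haar_integral_left bV haar_m q.1 (mFx q.2)) // -ge0_integralZl //.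
  apply: measurableT_comp (mFx q.2) _.
  by apply: (measurable_fun_mulg bV); [exact: measurable_cst|exact: measurable_id].
have hF2 q : F q = \int[m]_h F2 (h, q).
  have mwV : measurable_fun setT (fun h : borel_group G => w (h^-1)%g).
    by apply: measurableT_comp mw _; exact: measurable_invg.
  rewrite /F2 /= ge0_integralZr //; last first.
    apply: measurableT_comp mw _; apply: (measurable_fun_mulg bV) => //.
    exact: measurable_invg.
  rewrite -[LHS]mul1e; congr (_ * _).
  transitivity (\int[m]_h w (h^-1)%g).
    by rewrite (haar_integral_inv bV uG haar_m hw).
  rewrite -(haar_integral_right bV uG haar_m q.1^-1%g mwV) //.
  by apply: eq_integral => h _; rewrite invgM invgK.
transitivity (\int[mu]_x orbit_sum act (cs_set Y) (fun q => \int[m]_h F2 (h, q)) x).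
  by apply: eq_integral => x _; apply: eq_orbit_sum => g y _; exact: hF2.
transitivity (\int[mu]_x orbit_sum act (cs_set Y) (fun q => \int[m]_h F1 (h, q)) x); last first.
  apply: eq_integral => x _; apply: eq_esum => g Yg.
  by rewrite -hF1 muleC cs_extendE // /= cs_retractK.
have shift h : \int[mu]_x orbit_sum act (cs_set Y) (fun q => F2 (h, q)) x =
    \int[mu]_x orbit_sum act (cs_set Y) (fun q => F1 (h, q)) x.
  rewrite -(orbit_sum_shift (F := fun q => F2 (h, q)) h inv); last 2 first.
  - by apply: measurableT_comp mF2 _; exact: pair1_measurable.
  - by move=> p.
  by apply: eq_integral => x _; apply: eq_esum => g _; rewrite /F1 /F2 /= mulgK.
apply: etrans (swap F2 mF2 F20) _; apply: etrans _ (esym (swap F1 mF1 F10)).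
by apply: eq_integral => h _; exact: shift.
Qed.

End transverse_mecke.

(** * Selecting one point of each return set *)

Section esum_lemmas.
Context (R : realType) (T : choiceType).
Implicit Types (A : set T) (a : T -> \bar R).

Lemma esum_one A a t : A t -> 0 <= a t -> (forall s, A s -> s <> t -> a s = 0) ->
  \esum_(s in A) a s = a t.
Proof.
move=> At at0 a0; rewrite (esumID [set t]); last first.
  by move=> s As; have [->//|/eqP/(a0 _ As) ->] := eqVneq s t.
rewrite (_ : A `&` [set t] = [set t]); last first.
  by rewrite eqEsubset; split=> [s []//|s ->].
rewrite esum_set1 // esum1 ?adde0 // => s [As /= st].
exact: a0.
Qed.

Lemma le_esum_one A a t : A t -> (forall s, A s -> 0 <= a s) ->
  a t <= \esum_(s in A) a s.
Proof.
move=> At a0; rewrite (esumID [set t]) //.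
rewrite (_ : A `&` [set t] = [set t]); last first.
  by rewrite eqEsubset; split=> [s []//|s ->].
by rewrite esum_set1 ?a0 // leeDl //; apply: esum_ge0 => s [As _]; exact: a0.
Qed.

Lemma esum_indic A (P : set T) a :
  \esum_(s in A `&` P) a s = \esum_(s in A) ((\1_P s)%:E * a s).
Proof.
rewrite esum_mkcondr; apply: eq_esum => s _; rewrite indicE.
by case: ifP => _; rewrite ?mul1e ?mul0e.
Qed.

End esum_lemmas.

Lemma measurable_first_choice d (T : measurableType d) d' (U : measurableType d')
    (u0 : U) (B : nat -> set T) (f : nat -> T -> U) :
  (forall n, measurable (B n)) -> (forall n, measurable_fun setT (f n)) ->
  exists2 h : T -> U, measurable_fun setT h &
    forall x n, B n x -> exists2 k, B k x & h x = f k x.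
Proof.
move=> mB mf; pose A := seqDU B.
have mA n : measurable (A n) by exact: seqDU_measurable.
pose h x := if pselect (exists n, A n x) is left e then f (projT1 (cid e)) x else u0.
have hA n x : A n x -> h x = f n x.
  move=> Anx; rewrite /h; case: pselect => [e|[]]; last by exists n.
  case: cid => k /= Akx; suff -> : k = n by [].
  by apply: (@trivIset_seqDU _ B k n) => //; exists x.
have h0 x : ~ (\bigcup_n A n) x -> h x = u0.
  by rewrite /h; case: pselect => // -[n Anx] []; exists n.
exists h; last first.
  move=> x n Bx; have : (\bigcup_n A n) x by rewrite -seqDU_bigcup_eq; exists n.
  by move=> [k _ Ak]; exists k; [exact: subset_seqDU Ak|exact: hA].
move=> _ C mC; rewrite setTI.
rewrite (_ : h @^-1` C = (\bigcup_n (A n `&` f n @^-1` C)) `|`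
   (if `[< C u0 >] then ~` \bigcup_n A n else set0)).
  apply: measurableU.
    apply: bigcup_measurable => n _; apply: measurableI => //.
    by rewrite -[X in measurable X]setTI; exact: mf.
  case: asboolP => // _; apply: measurableC; exact: bigcup_measurable.
rewrite eqEsubset; split=> x /=.
  have [[n _ Anx]|nA] := pselect ((\bigcup_n A n) x).
    by rewrite (hA n) // => Cx; left; exists n.
  by rewrite h0 // => Cu; right; case: asboolP.
case=> [[n _ [Anx Cx]]|]; first by rewrite (hA n).
by case: asboolP => // Cu nA; rewrite h0.
Qed.

Lemma restr_measurable_fun d (T : measurableType d) (A : set T) (tau : T -> T) :
  measurable A -> measurable_fun A tau ->
  exists2 tau', measurable_fun setT tau' & forall x, A x -> tau' x = tau x.
Proof.
move=> mA mtau.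
exists (fun x => if x \in A then tau x else x); last by move=> x /mem_set ->.
move=> _ C mC; rewrite setTI.
rewrite (_ : _ @^-1` C = (A `&` tau @^-1` C) `|` (~` A `&` C)).
  by apply: measurableU; [exact: mtau|apply: measurableI => //; exact: measurableC].
rewrite eqEsubset; split=> x /=; have [Ax|nAx] := pselect (A x).
- by rewrite mem_set //; left.
- by rewrite memNset //; right.
- by rewrite mem_set // => -[[]|[]].
- by rewrite memNset // => -[[]|[]].
Qed.

Section selector.
Context (R : realType) (G : topologicalGroupType) (V : nat -> set G).
Hypotheses (bV : base_seq V) (hG : hausdorff_space G).
Context d (X : measurableType d) (act : G -> X -> X) (bact : borel_action act).
Context (Y : cross_section act) (D : nat -> set X) (gam : nat -> X -> borel_group G).
Hypothesis en : enumeration act (cs_set Y) D gam.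

Lemma return_selector : exists2 beta : X -> borel_group G, measurable_fun setT beta &
  forall x, cs_set Y (act (beta x) x).
Proof.
have [beta mb Hb] := measurable_first_choice (point : borel_group G) (enum_dom en) (enum_fun en).
exists beta => // x; have [g Yg] := cs_nonempty Y x.
have [n Dx _] := enum_surj en Yg; have [k Dk ->] := Hb x n Dx.
exact: enum_in en _ _ Dk.
Qed.

Lemma measurable_diag_fun d' (T : measurableType d') (f g : T -> borel_group G) :
  measurable_fun setT f -> measurable_fun setT g -> measurable [set t | f t = g t].
Proof.
move=> mf mg; rewrite -[X in measurable X]setTI.
exact: (measurable_fun_pair mf mg measurableT (measurable_diag bV hG)).
Qed.

Lemma measurable_act_inv : measurable_fun setT
  (fun p : borel_group G * X => act (p.1^-1)%g p.2).
Proof.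
have mV : measurable_fun setT
    (fun p : borel_group G * X => (p.1^-1)%g : borel_group G).
  exact: measurable_fun_invg measurable_fst.
exact: measurable_fun_act bact mV measurable_snd.
Qed.

Context (beta : X -> borel_group G).
Hypotheses (mbeta : measurable_fun setT beta) (Ybeta : forall x, cs_set Y (act (beta x) x)).

(** Among the pairs [(g, gx)] over one point [x] exactly one is selected, so that
    the indicator of this set has sum 1 over every return set. *)
Definition selected : set (borel_group G * X) :=
  [set p | beta (act (p.1^-1)%g p.2) = p.1].

Lemma measurable_selected : measurable selected.
Proof.
apply: measurable_diag_fun; last exact: measurable_fst.
exact: measurableT_comp mbeta measurable_act_inv.
Qed.

Lemma orbit_sum_selected (f : X -> \bar R) (h : G) x : (forall x, 0 <= f x) ->
  orbit_sum act (cs_set Y) (fun p => f (act (p.1^-1)%g p.2) *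
    (\1_selected ((p.1 * h)%g, p.2))%:E) x = f x.
Proof.
move=> f0; pose g := (beta (act h^-1 x) * h^-1)%g.
have actK k z : act (k^-1)%g (act k z) = z.
  by rewrite -(act_mul bact) mulVg (act_one bact).
have selE k : selected ((k * h)%g, act k x) <-> k = g.
  rewrite /selected /= invgM (act_mul bact) actK /g; split=> [->|->].
    by rewrite mulgK.
  by rewrite mulgVK.
rewrite /orbit_sum (@esum_one _ _ _ _ g).
- by rewrite actK indicE mem_set ?mule1 //; exact/selE.
- by rewrite /return_set /= /g (act_mul bact).
- exact: mule_ge0.
- move=> k _ kg; rewrite indicE memNset ?mule0 // => /selE.
  exact.
Qed.

End selector.

(** * Existence and sigma-finiteness *)

Section transverse_measure.
Context (R : realType) (G : topologicalGroupType) (V : nat -> set G).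
Hypotheses (bV : base_seq V) (hG : hausdorff_space G) (lcG : locally_compact [set: G]).
Hypothesis uG : unimodular R G.
Context (m : {sigma_finite_measure set (borel_group G) -> \bar R}).
Hypothesis haar_m : haar_measure m.
Context d (X : measurableType d) (act : G -> X -> X) (bact : borel_action act).
Context (Y : cross_section act) (D : nat -> set X) (gam : nat -> X -> borel_group G).
Hypothesis en : enumeration act (cs_set Y) D gam.
Implicit Types (mu : {sigma_finite_measure set X -> \bar R}).
Implicit Types (nu : {measure set Y -> \bar R}).

Let actK g x : act (g^-1)%g (act g x) = x.
Proof. by rewrite -(act_mul bact) mulVg (act_one bact). Qed.

Let actVK g x : act g (act (g^-1)%g x) = x.
Proof. by rewrite -(act_mul bact) mulgV (act_one bact). Qed.

Lemma haar_pos_set : exists K : set (borel_group G),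
  [/\ measurable K, 0 < m K & m K < +oo].
Proof.
have [K [cK covK]] := compact_exhaustion lcG bV.
have mK i : measurable (K i : set (borel_group G)).
  by apply: closed_borel; exact: compact_closed.
have [[i Ki]|K0] := pselect (exists i, m (K i) != 0).
  exists (K i); split => //; first by rewrite lt0e Ki measure_ge0.
  exact: (haar_compact_fin haar_m).
case: (haar_neq0 haar_m).
have -> : [set: G] = \bigcup_i K i.
  by rewrite eqEsubset; split=> // g _; have [i Ki] := covK g; exists i.
apply: measure_bigcup_null => // i; apply: contrapT => Ki; apply: K0; exists i.
exact/eqP.
Qed.

(** With the indicator of a set of finite positive Haar measure as weight, the
    transverse measure is an image of a restriction of the Campbell measure. *)
Lemma mecke_exists mu : action_invariant act mu -> exists nu, mecke m mu nu.
Proof.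
move=> inv; have [K [mK K0 Koo]] := haar_pos_set.
have mKfin : m K \is a fin_num by rewrite ge0_fin_numE // measure_ge0.
have k0 : (0 < fine (m K))%R by rewrite fine_gt0 // K0.
have c0 : (0 <= (fine (m K))^-1)%R by rewrite invr_ge0 ltW.
pose c : {nonneg R} := NngNum c0.
have [kappa Hk] := campbell_measure bact en mu.
have mK' : measurable (K `*` setT : set (borel_group G * X)) by exact: measurableX.
have [nu0 Hnu0] := restr_pushforward kappa mK'
  (measurableT_comp (@measurable_cs_retract _ _ _ _ Y) (@measurable_snd _ _ (borel_group G) X)).
exists (mscale c nu0).
pose w (g : borel_group G) : \bar R := (c%:num * \1_K g)%:E.
have hw : transverse_weight m w.
  split.
  - apply/measurable_EFinP; apply: measurable_funM => //; exact: measurable_indic.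
  - by move=> g; rewrite lee_fin mulr_ge0.
  - rewrite /w; under eq_integral do rewrite EFinM.
    rewrite ge0_integralZl_EFin //; last first.
      by apply/measurable_EFinP; exact: measurable_indic.
    rewrite integral_indic // setIT.
    transitivity ((fine (m K))^-1%:E * (fine (m K))%:E); first by rewrite fineK.
    by rewrite -EFinM mulVf // lt0r_neq0.
apply: (transverse_mecke bV uG haar_m bact en inv hw) => f mf f0.
rewrite ge0_integral_mscale // Hnu0 //.
have mH : measurable_fun setT (fun p : borel_group G * X =>
    (f \o (cs_retract Y \o snd)) p * (\1_(K `*` setT) p)%:E).
  apply: emeasurable_funM; last by apply/measurable_EFinP; exact: measurable_indic.
  apply: measurableT_comp mf _.
  exact: measurableT_comp (@measurable_cs_retract _ _ _ _ Y) measurable_snd.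
have H0 (p : borel_group G * X) : 0 <= (f \o (cs_retract Y \o snd)) p * (\1_(K `*` setT) p)%:E.
  by apply: mule_ge0; [exact: f0|rewrite lee_fin].
rewrite -ge0_integralZl_EFin //; last by move=> p _; exact: H0.
apply: etrans (Hk (fun p => c%:num%:E * (f (cs_retract Y p.2) * (\1_(K `*` setT) p)%:E)) _ _) _.
- exact: measurable_funeM.
- by move=> p; apply: mule_ge0 => //; exact: H0.
apply: eq_integral => x _; apply: eq_esum => g Yg /=.
rewrite cs_extendE // muleCA /w EFinM; congr (_ * (_ * _)).
by rewrite !indicE /= in_setX in_setT andbT.
Qed.

(** If [mu (F i)] is finite, then so is the integral over [nu] of the Haar measure
    of the [g] that the [n]-th enumerating function attaches to [g^-1 y], restricted
    to the [g^-1 y] in [F i]. For fixed [y] these countably many sets of [g] cover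
    the group, so that one of them is not negligible. *)
Lemma mecke_sigma_finite mu nu : mecke m mu nu -> sigma_finite setT nu.
Proof.
move=> mk; have [F UF HF] := sigma_finiteT mu.
pose S (i : nat * nat) : set (borel_group G * X) :=
  [set p | F i.1 (act (p.1^-1)%g p.2)] `&`
  ([set p | D i.2 (act (p.1^-1)%g p.2)] `&`
   [set p | gam i.2 (act (p.1^-1)%g p.2) = p.1]).
have mact := measurable_act_inv bact.
have mS i : measurable (S i).
  apply: measurableI; last apply: measurableI.
  - by rewrite -[X in measurable X]setTI; apply: mact => //; have [] := HF i.1.
  - by rewrite -[X in measurable X]setTI; apply: mact => //; exact: enum_dom en _.
  - apply: (measurable_diag_fun bV hG); last exact: measurable_fst.
    exact: measurableT_comp (enum_fun en _) mact.
have mI i : measurable_fun setT (fun p => (\1_(S i) p)%:E : \bar R).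
  by apply/measurable_EFinP; exact: measurable_indic.
apply: (@sigma_finite_integral _ _ _ nu (nat * nat)%type
  (fun i y => \int[m]_g (\1_(S i) (g, cs_val y))%:E)).
- move=> i; apply: (measurableT_comp (f := fun x => \int[m]_g (\1_(S i) (g, x))%:E)).
    exact: (@measurable_integral_haar _ _ m _ _ (fun p => (\1_(S i) p)%:E)).
  exact: measurable_cs_val.
- by move=> i y; exact: integral_ge0.
- move=> i; rewrite -(mk (fun p => (\1_(S i) p)%:E)) //.
  have [mF Foo] := HF i.1; apply: le_lt_trans Foo.
  apply: (@le_trans _ _ (\int[mu]_x (\1_(F i.1) x)%:E)); last first.
    by rewrite integral_indic // setIT.
  apply: ge0_le_integral => //.
  + by move=> x _; exact: orbit_sum_ge0.
  + exact: (measurable_orbit_sum bact en).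
  + by apply/measurable_EFinP; exact: measurable_indic.
  move=> x _.
  have [Fx|nFx] := pselect (F i.1 x /\ D i.2 x); last first.
    rewrite /orbit_sum esum1 // => g _; rewrite indicE memNset //.
    by case=> /=; rewrite actK => Fx [Dx _]; apply: nFx.
  case: Fx => Fx Dx.
  rewrite /orbit_sum (@esum_one _ _ _ _ (gam i.2 x)) //.
  + by rewrite !indicE (mem_set Fx) lee_fin; case: (_ \in _).
  + exact: enum_in en _ _ Dx.
  + move=> g _ gg; rewrite indicE memNset // => -[_ [_ /=]].
    by rewrite actK => e; apply: gg.
- move=> y; apply: contrapT => /forallNP phi0.
  have S0 i : m [set g | S i (g, cs_val y)] = 0.
    have := phi0 i; rewrite -[X in integral _ _ X]/(fun g => (\1_[set g | S i (g, cs_val y)] g)%:E).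
    rewrite integral_indic //; last first.
      by rewrite -[X in measurable X]setTI; exact: pair2_measurable (mS i).
    by rewrite setIT lt0e measure_ge0 andbT => /negP/negPn/eqP.
  case: (haar_neq0 haar_m).
  have mS' i : measurable [set g : borel_group G | S i (g, cs_val y)].
    by rewrite -[X in measurable X]setTI; exact: pair2_measurable (mS i).
  pose U n : set (borel_group G) := if unpickle n is Some i then [set g | S i (g, cs_val y)] else set0.
  have mU n : measurable (U n) by rewrite /U; case: unpickle.
  have -> : [set: G] = \bigcup_n U n.
    rewrite eqEsubset; split=> // g _.
    have : (\bigcup_n F n) (act (g^-1)%g (cs_val y)) by rewrite -UF.
    move=> [i _ Fi].
    have [|n Dn gn] := @enum_surj _ _ _ _ _ _ _ en (act (g^-1)%g (cs_val y)) g.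
      by rewrite actVK; exact: cs_valP.
    by exists (pickle (i, n)) => //; rewrite /U pickleK.
  apply: measure_bigcup_null => // n.
  by rewrite /U; case: unpickle => [i|]; [exact: S0|exact: measure0].
Qed.

End transverse_measure.

(** * Invariance and injectivity *)

Lemma preimage_indicE (R : pzRingType) (T U : Type) (h : T -> U) (B : set U) (t : T) :
  \1_(h @^-1` B) t = \1_B (h t) :> R.
Proof.
by rewrite !indicE; congr ((nat_of_bool _)%:R)%R; apply/idP/idP; rewrite !inE.
Qed.

Lemma measurable_indic_comp d (T : measurableType d) d' (U : measurableType d')
    (R : realType) (h : T -> U) (B : set U) :
  measurable_fun setT h -> measurable B ->
  measurable_fun setT (fun t => (\1_B (h t))%:E : \bar R).
Proof.
move=> mh mB; apply/measurable_EFinP.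
by apply: measurableT_comp mh; exact: measurable_indic.
Qed.

Section invariance.
Context (R : realType) (G : topologicalGroupType) (V : nat -> set G).
Hypotheses (bV : base_seq V) (hG : hausdorff_space G).
Context (m : {sigma_finite_measure set (borel_group G) -> \bar R}).
Hypothesis haar_m : haar_measure m.
Context d (X : measurableType d) (act : G -> X -> X) (bact : borel_action act).
Hypothesis diagX : measurable [set p : X * X | p.1 = p.2].
Context (Y : cross_section act) (D : nat -> set X) (gam : nat -> X -> borel_group G).
Hypothesis en : enumeration act (cs_set Y) D gam.
Implicit Types (mu : {measure set X -> \bar R}) (nu : {measure set Y -> \bar R}).

Let actK g x : act (g^-1)%g (act g x) = x.
Proof. by rewrite -(act_mul bact) mulVg (act_one bact). Qed.

Let actVK g x : act g (act (g^-1)%g x) = x.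
Proof. by rewrite -(act_mul bact) mulgV (act_one bact). Qed.

Let mval := @measurable_cs_val _ _ _ act Y.
Let mret := @measurable_cs_retract _ _ _ act Y.

(** For each [y] in [A] some enumerating function at [y] reaches [tau y]; taking
    the first one makes the choice measurable. *)
Lemma orbit_rel_displacement (A : set Y) (tau : Y -> Y) :
  measurable A -> measurable_fun A tau ->
  (forall y, A y -> orbit_rel y (tau y)) ->
  exists2 phi : Y -> borel_group G, measurable_fun setT phi &
    forall y, A y -> act (phi y) (cs_val y) = cs_val (tau y).
Proof.
move=> mA mtau orb; have [tau' mtau' tauE] := restr_measurable_fun mA mtau.
pose B n : set Y := A `&` ((D n \o @cs_val _ _ _ _ Y) `&`
  [set y | act (gam n (cs_val y)) (cs_val y) = cs_val (tau' y)]).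
have mgam n : measurable_fun setT (fun y : Y => gam n (cs_val y)).
  exact: measurableT_comp (enum_fun en n) mval.
have mB n : measurable (B n).
  apply: measurableI => //; apply: measurableI.
    by rewrite -[X in measurable X]setTI; apply: mval => //; exact: enum_dom en n.
  have m1 := measurable_fun_act bact (mgam n) mval.
  have m2 := measurableT_comp mval mtau'.
  rewrite -[X in measurable X]setTI.
  exact: (measurable_fun_pair m1 m2 measurableT diagX).
have [phi mphi Hphi] := measurable_first_choice (point : borel_group G) mB mgam.
exists phi => // y Ay.
have [g eg] : exists g, act g (cs_val y) = cs_val (tau y).
  have : range (act^~ (cs_val (tau y))) (cs_val (tau y)).
    by exists 1%g => //; rewrite (act_one bact).
  by rewrite -(orb y Ay) => -[g _ <-]; exists g.
have [|n Dn gn] := @enum_surj _ _ _ _ _ _ _ en (cs_val y) g.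
  by rewrite eg; exact: cs_valP.
have [|k [_ [_ ek]] ->] := Hphi y n; last by rewrite ek tauE.
by split=> //; split=> //=; rewrite gn eg tauE.
Qed.

(** Moving [g] to [phi(gx) g] is a bijection from the [g] with [gx] in [A] onto
    those with [gx] in [B]; by invariance of Haar measure it does not change the
    integral of the weight. *)
Lemma mecke_orbit_invariant mu nu w : transverse_weight m w -> mecke m mu nu ->
  forall (A B : set Y) (tau : Y -> Y), measurable A -> measurable B ->
    measurable_fun A tau -> set_bij A B tau ->
    (forall y, A y -> orbit_rel y (tau y)) -> nu A = nu B.
Proof.
move=> [mw w0 w1] mk A B tau mA mB mtau [tauAB tauI tauS] orb.
have [phi mphi phiE] := orbit_rel_displacement mA mtau orb.
have mr2 : measurable_fun setT (fun p : borel_group G * X => cs_retract Y p.2).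
  exact: measurableT_comp mret measurable_snd.
pose F1 (p : borel_group G * X) := (\1_B (cs_retract Y p.2))%:E * w p.1.
pose F2 (p : borel_group G * X) :=
  (\1_A (cs_retract Y p.2))%:E * w (phi (cs_retract Y p.2) * p.1)%g.
have mF1 : measurable_fun setT F1.
  apply: emeasurable_funM; first exact: measurable_indic_comp.
  exact: measurableT_comp mw measurable_fst.
have mF2 : measurable_fun setT F2.
  apply: emeasurable_funM; first exact: measurable_indic_comp.
  apply: measurableT_comp mw _; apply: (measurable_fun_mulg bV) measurable_fst.
  exact: measurableT_comp mphi mr2.
have F10 p : 0 <= F1 p by apply: mule_ge0; rewrite ?lee_fin.
have F20 p : 0 <= F2 p by apply: mule_ge0; rewrite ?lee_fin.
have nuE (C : set Y) : measurable C -> nu C = \int[nu]_y (\1_C y)%:E.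
  by move=> mC; rewrite integral_indic // setIT.
transitivity (\int[nu]_y \int[m]_g F2 (g, cs_val y)).
  rewrite nuE //; apply: eq_integral => y _.
  rewrite /F2 /= cs_valK ge0_integralZl //; last first.
    apply: measurableT_comp mw _.
    by apply: (measurable_fun_mulg bV); [exact: measurable_cst|exact: measurable_id].
  by rewrite (haar_integral_left bV haar_m) // w1 mule1.
transitivity (\int[nu]_y \int[m]_g F1 (g, cs_val y)); last first.
  rewrite nuE //; apply: eq_integral => y _.
  by rewrite /F1 /= cs_valK ge0_integralZl ?lee_fin // w1 mule1.
apply: etrans (esym (mk F2 mF2 F20)) (etrans _ (mk F1 mF1 F10)).
apply: eq_integral => x _.
pose ret g := cs_retract Y (act g x).
transitivity (\esum_(g in return_set act (cs_set Y) x `&` ret @^-1` A)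
    w (phi (ret g) * g)%g).
  by rewrite esum_indic; apply: eq_esum => g _; rewrite preimage_indicE.
transitivity (\esum_(g in return_set act (cs_set Y) x `&` ret @^-1` B) w g); last first.
  by rewrite esum_indic; apply: eq_esum => g _; rewrite preimage_indicE.
symmetry; apply: (@reindex_esum _ _ _ _ _ (fun g => (phi (ret g) * g)%g)).
have moved g : cs_set Y (act g x) -> A (ret g) ->
    act (phi (ret g) * g)%g x = cs_val (tau (ret g)).
  by move=> Yg Ag; rewrite (act_mul bact) -phiE // cs_retractK.
split.
- move=> g [Yg Ag]; split; rewrite /return_set /= /ret.
    by rewrite moved //; exact: cs_valP.
  by rewrite moved // cs_valK; exact: tauAB.
- move=> g g'; rewrite !inE => -[Yg Ag] [Yg' Ag'] e.
  have et : ret g = ret g'.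
    apply: tauI; rewrite ?inE //; apply: cs_val_inj.
    by rewrite -!moved // e.
  by move: e; rewrite et => /mulgI.
- move=> h [Yh Bh]; have [y Ay ey] := tauS _ Bh.
  have acth : act ((phi y)^-1 * h)%g x = cs_val y.
    by rewrite (act_mul bact) -(cs_retractK Yh) -/(ret h) -ey -phiE // actK.
  have reth : ret ((phi y)^-1 * h)%g = y by rewrite /ret acth cs_valK.
  exists ((phi y)^-1 * h)%g; last by rewrite reth mulVKg.
  split; first by rewrite /return_set /= acth; exact: cs_valP.
  by rewrite /= reth.
Qed.

(** The Mecke formula for [F(g, y) = f(g^-1 y)] restricted to the selected pairs;
    it recovers [mu] from [nu]. A translate of the selection serves as well, and
    this freedom gives the invariance of [mu] in the converse construction. *)
Lemma mecke_measureE mu nu (beta : X -> borel_group G) : mecke m mu nu ->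
  measurable_fun setT beta -> (forall x, cs_set Y (act (beta x) x)) ->
  forall f : X -> \bar R, measurable_fun setT f -> (forall x, 0 <= f x) ->
  forall h : G, \int[mu]_x f x =
    \int[nu]_y \int[m]_g (f (act (g^-1)%g (cs_val y)) *
      (\1_(selected act beta) ((g * h)%g, cs_val y))%:E).
Proof.
move=> mk mbeta Ybeta f mf f0 h.
rewrite -(mk (fun p => f (act (p.1^-1)%g p.2) *
  (\1_(selected act beta) ((p.1 * h)%g, p.2))%:E)).
- by apply: eq_integral => x _; rewrite (orbit_sum_selected bact).
- apply: emeasurable_funM.
    exact: measurableT_comp mf (measurable_act_inv bact).
  have mh : measurable_fun setT
      (fun p : borel_group G * X => ((p.1 * h)%g : borel_group G, p.2)).
    apply: measurable_fun_pair; last exact: measurable_snd.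
    by apply: (measurable_fun_mulg bV); [exact: measurable_fst|exact: measurable_cst].
  apply/measurable_EFinP; apply: measurableT_comp mh.
  by apply: measurable_indic; exact: (measurable_selected bV hG bact).
- by move=> p; apply: mule_ge0; rewrite ?lee_fin.
Qed.

Lemma mecke_injective mu1 mu2 nu1 nu2 : mecke m mu1 nu1 -> mecke m mu2 nu2 ->
  measure_eq nu1 nu2 -> measure_eq mu1 mu2.
Proof.
move=> mk1 mk2 nu12 A mA.
have [beta mbeta Ybeta] := return_selector en.
have muE (mu : {measure set X -> \bar R}) : mu A = \int[mu]_x (\1_A x)%:E.
  by rewrite integral_indic // setIT.
have mI : measurable_fun setT (fun x => (\1_A x)%:E : \bar R).
  by apply/measurable_EFinP; exact: measurable_indic.
have I0 x : 0 <= (\1_A x)%:E :> \bar R by rewrite lee_fin.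
rewrite !muE (mecke_measureE mk1 mbeta Ybeta mI I0 1%g).
rewrite (mecke_measureE mk2 mbeta Ybeta mI I0 1%g).
by apply: eq_measure_integral => B mB _; exact: nu12.
Qed.

End invariance.

(** * From a measure on the cross section to an invariant measure *)

Section converse.
Context (R : realType) (G : topologicalGroupType) (V : nat -> set G).
Hypotheses (bV : base_seq V) (hG : hausdorff_space G) (uG : unimodular R G).
Context (m : {sigma_finite_measure set (borel_group G) -> \bar R}).
Hypothesis haar_m : haar_measure m.
Context d (X : measurableType d) (act : G -> X -> X) (bact : borel_action act).
Context (Y : cross_section act) (D : nat -> set X) (gam : nat -> X -> borel_group G).
Hypothesis en : enumeration act (cs_set Y) D gam.
Context (nu : {sigma_finite_measure set Y -> \bar R}) (inv : orbit_rel_invariant nu).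

Let actK g x : act (g^-1)%g (act g x) = x.
Proof. by rewrite -(act_mul bact) mulVg (act_one bact). Qed.

Let mval := @measurable_cs_val _ _ _ act Y.
Let mret := @measurable_cs_retract _ _ _ act Y.

Lemma orbit_invariant_integral (A B : set Y) (tau : Y -> Y) (f : Y -> \bar R) :
  measurable A -> measurable B -> measurable_fun setT tau -> set_bij A B tau ->
  (forall y, A y -> orbit_rel y (tau y)) ->
  measurable_fun setT f -> (forall y, 0 <= f y) ->
  \int[nu]_y (f (tau y) * (\1_A y)%:E) = \int[nu]_y (f y * (\1_B y)%:E).
Proof.
move=> mA mB mtau [tauAB tauI tauS] orb mf f0.
rewrite -(ge0_integral_mrestr nu mB) //.
rewrite -(ge0_integral_mrestr nu mA (f := fun y => f (tau y))) //; last first.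
  exact: measurableT_comp mf mtau.
transitivity (\int[pushforward (mrestr nu mA) tau]_y f y).
  by rewrite (ge0_integral_pushforward mtau).
apply: eq_measure_integral => C mC _; rewrite /= /pushforward /mrestr.
apply: (inv (tau := tau)).
- by apply: measurableI => //; rewrite -[X in measurable X]setTI; exact: mtau.
- exact: measurableI.
- exact: measurable_funTS.
- split.
  + by move=> y [/= Cy Ay]; split => //; exact: tauAB.
  + by move=> y z; rewrite !inE => -[_ Ay] [_ Az]; apply: tauI; rewrite inE.
  + by move=> z [Cz Bz]; have [y Ay yz] := tauS z Bz; exists y; rewrite //= yz.
- by move=> y [_ Ay]; exact: orb.
Qed.

Let tau n (y : Y) : Y := cs_retract Y (act (gam n (cs_val y)) (cs_val y)).

Let mtau n : measurable_fun setT (tau n).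
Proof.
apply: measurableT_comp mret _.
apply: (measurable_fun_act bact) mval.
exact: measurableT_comp (enum_fun en n) mval.
Qed.

Let tau_val n y : D n (cs_val y) ->
  cs_val (tau n y) = act (gam n (cs_val y)) (cs_val y).
Proof. by move=> Dy; rewrite /tau cs_retractK //; exact: enum_in en _ _ Dy. Qed.

Let Dn n : set Y := D n \o @cs_val _ _ _ _ Y.

Let mDn n : measurable (Dn n).
Proof. by rewrite -[X in measurable X]setTI; apply: mval => //; exact: enum_dom en n. Qed.

Let gm n (y : Y) : borel_group G := gam n (cs_val y).

Let mgm n : measurable_fun setT (gm n).
Proof. exact: measurableT_comp (enum_fun en n) mval. Qed.

(* the points that [gam n] sends to a point that [gam j] sends back *)
Let piece n j : set Y :=
  Dn n `&` (tau n @^-1` Dn j `&` [set y | gm j (tau n y) = ((gm n y)^-1)%g]).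

Let mpiece n j : measurable (piece n j).
Proof.
apply: measurableI => //; apply: measurableI.
  by rewrite -[X in measurable X]setTI; exact: mtau.
apply: (measurable_diag_fun bV hG).
  exact: measurableT_comp (mgm j) (mtau n).
exact: measurable_fun_invg (mgm n).
Qed.

Let tauK n j y : piece n j y -> piece j n (tau n y) /\ tau j (tau n y) = y.
Proof.
move=> [Dy [Dty gg]].
have e : tau j (tau n y) = y.
  rewrite {1}/tau -/(gm j (tau n y)) gg tau_val // actK.
  exact: cs_valK.
split => //; split => //; split; rewrite /= e //.
by rewrite gg invgK.
Qed.

Let piece_bij n j : set_bij (piece n j) (piece j n) (tau n).
Proof.
split.
- by move=> y /tauK[].
- move=> y z; rewrite !inE => /tauK[_ yK] /tauK[_ zK] e.
  by rewrite -yK e zK.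
- by move=> z /tauK[pz zK]; exists (tau j z).
Qed.

Let orbit_tau n y : Dn n y -> orbit_rel y (tau n y).
Proof.
move=> Dy; rewrite /orbit_rel tau_val // eqEsubset; split=> _ [g _ <-].
  exists (g * (gm n y)^-1)%g => //; rewrite (act_mul bact).
  by rewrite actK.
by exists (g * gm n y)%g => //; rewrite (act_mul bact).
Qed.

Let piece_sum n y (c : \bar R) : Dn n y -> 0 <= c ->
  \sum_(j <oo) (c * (\1_(piece n j) y)%:E) = c.
Proof.
move=> Dy c0; rewrite nneseries_esumT; last first.
  by move=> j; apply: mule_ge0; rewrite ?lee_fin.
have Ytau : cs_set Y (act ((gm n y)^-1)%g (cs_val (tau n y))).
  by rewrite tau_val // actK; exact: cs_valP.
have [j Dj gj] := enum_surj en Ytau.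
have pj : piece n j y by [].
rewrite (@esum_one _ _ _ _ j) //.
- by rewrite indicE mem_set // mule1.
- by apply: mule_ge0; rewrite ?lee_fin.
- move=> k _ kj; rewrite indicE memNset ?mule0 // => -[_ [Dk gk]].
  apply: kj; apply: (enum_inj en Dk Dj).
  by rewrite gj -gk.
Qed.

(** Mass transport for an invariant measure: on [piece n j] the map [tau n] is a
    partial isomorphism onto [piece j n], with inverse [tau j]; it exchanges the
    terms for [k] and [k^-1]. *)
Lemma mass_transport (H : borel_group G * X -> \bar R) :
  measurable_fun setT H -> (forall p, 0 <= H p) ->
  \int[nu]_y orbit_sum act (cs_set Y) H (cs_val y) =
  \int[nu]_y orbit_sum act (cs_set Y)
    (fun p => H (p.1^-1, act p.1^-1 p.2)%g) (cs_val y).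
Proof.
move=> mH H0.
pose a n (y : Y) := H (gm n y, cs_val (tau n y)).
pose b n (y : Y) := H (((gm n y)^-1)%g, cs_val y).
have ma n : measurable_fun setT (a n).
  apply: measurableT_comp mH _; apply: measurable_fun_pair => //.
  exact: measurableT_comp mval (mtau n).
have mb n : measurable_fun setT (b n).
  apply: measurableT_comp mH _; apply: measurable_fun_pair => //.
  exact: measurable_fun_invg (mgm n).
have mI n j : measurable_fun setT (fun y => (\1_(piece n j) y)%:E : \bar R).
  by apply/measurable_EFinP; exact: measurable_indic.
have split_sum (c : nat -> Y -> \bar R) : (forall n, measurable_fun setT (c n)) ->
    (forall n y, 0 <= c n y) ->
    \int[nu]_y \sum_(n <oo) (c n y * (\1_(Dn n) y)%:E) =
    \sum_(n <oo) \sum_(j <oo) \int[nu]_y (c n y * (\1_(piece n j) y)%:E).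
  move=> mc c0; rewrite integral_nneseries //; last 2 first.
  - move=> n; apply: emeasurable_funM => //.
    by apply/measurable_EFinP; exact: measurable_indic.
  - by move=> n y _; apply: mule_ge0; rewrite ?lee_fin.
  apply: eq_eseriesr => n _; rewrite -integral_nneseries //; last 2 first.
  - by move=> j; exact: emeasurable_funM.
  - by move=> j y _; apply: mule_ge0; rewrite ?lee_fin.
  apply: eq_integral => y _.
  have [Dy|nDy] := pselect (Dn n y).
    by rewrite piece_sum // indicE mem_set // mule1.
  rewrite indicE memNset // mule0 eseries0 // => j _ _.
  by rewrite indicE memNset ?mule0 // => -[].
transitivity (\int[nu]_y \sum_(n <oo) (a n y * (\1_(Dn n) y)%:E)).
  apply: eq_integral => y _.
  rewrite /orbit_sum (esum_enumeration en (cs_val y) (a := fun g => H (g, act g (cs_val y)))) //.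
  apply: eq_eseriesr => n _; rewrite (preimage_indicE _ (@cs_val _ _ _ _ Y)).
  have [Dy|nDy] := pselect (D n (cs_val y)); first by rewrite /a tau_val.
  by rewrite indicE memNset // !mule0.
transitivity (\int[nu]_y \sum_(n <oo) (b n y * (\1_(Dn n) y)%:E)); last first.
  apply: eq_integral => y _.
  rewrite /orbit_sum (esum_enumeration en (cs_val y)
    (a := fun g => H (g^-1, act g^-1 (act g (cs_val y)))%g)) //.
  apply: eq_eseriesr => n _; rewrite (preimage_indicE _ (@cs_val _ _ _ _ Y)).
  by rewrite actK.
have a0 n y : 0 <= a n y by exact: H0.
have b0 n y : 0 <= b n y by exact: H0.
rewrite (split_sum a ma a0) (split_sum b mb b0).
apply: etrans (nneseries_interchange xpredT xpredT _) _.
  by move=> n j; apply: integral_ge0 => y _; apply: mule_ge0; rewrite ?lee_fin.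
apply: eq_eseriesr => j _; apply: eq_eseriesr => n _.
rewrite -(orbit_invariant_integral (mpiece n j) (mpiece j n) (mtau n)) //.
- apply: eq_integral => y _.
  have [py|npy] := pselect (piece n j y).
    have [_ [_ gg]] := py.
    by rewrite /a /b gg invgK.
  by rewrite indicE memNset // !mule0.
- by move=> y [Dy _]; exact: orbit_tau.
Qed.

Context (beta : X -> borel_group G).
Hypotheses (mbeta : measurable_fun setT beta) (Ybeta : forall x, cs_set Y (act (beta x) x)).

Let S := selected act beta.

Let mS : measurable S.
Proof. exact: (measurable_selected bV hG bact). Qed.

Let mIS d' (T : measurableType d') (h : T -> borel_group G * X) :
  measurable_fun setT h -> measurable_fun setT (fun t => (\1_S (h t))%:E : \bar R).
Proof. by move=> mh; exact: measurable_indic_comp. Qed.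

(** The inverse construction: spread [nu] along the orbits by Haar measure, and
    count each point [x = g^-1 y] once, namely for [g = beta x]. *)
Lemma spread_measure : exists mu : {measure set X -> \bar R},
  forall f, measurable_fun setT f -> (forall x, 0 <= f x) ->
  \int[mu]_x f x = \int[nu]_y \int[m]_g
    (f (act (g^-1)%g (cs_val y)) * (\1_S (g, cs_val y))%:E).
Proof.
have ms0 : measurable_fun setT (fun p : borel_group G * Y => (p.1, cs_val p.2)).
  apply: measurable_fun_pair; first exact: measurable_fst.
  exact: measurableT_comp mval measurable_snd.
have ms : measurable_fun setT
    (fun p : borel_group G * Y => act (p.1^-1)%g (cs_val p.2)).
  exact: measurableT_comp (measurable_act_inv bact) ms0.
have mS' : measurable [set p : borel_group G * Y | S (p.1, cs_val p.2)].
  by rewrite -[X in measurable X]setTI; exact: ms0.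
have [mu Hmu] := restr_pushforward (m \x nu)%E mS' ms.
exists mu => f mf f0; rewrite Hmu //.
pose F (p : borel_group G * Y) := f (act (p.1^-1)%g (cs_val p.2)) *
  (\1_[set p : borel_group G * Y | S (p.1, cs_val p.2)] p)%:E.
have mF : measurable_fun setT F.
  apply: emeasurable_funM; first exact: measurableT_comp mf ms.
  by apply/measurable_EFinP; exact: measurable_indic.
have F0 p : 0 <= F p by apply: mule_ge0; rewrite ?lee_fin.
apply: etrans (@fubini_tonelli2 _ _ _ _ _ m nu F mF F0) _.
apply: eq_integral => y _; apply: eq_integral => g _.
by rewrite /F (preimage_indicE _ (fun p : borel_group G * Y => (p.1, cs_val p.2))).
Qed.

Context (mu : {measure set X -> \bar R}).
Hypothesis muE : forall f, measurable_fun setT f -> (forall x, 0 <= f x) ->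
  \int[mu]_x f x = \int[nu]_y \int[m]_g
    (f (act (g^-1)%g (cs_val y)) * (\1_S (g, cs_val y))%:E).

(** A point [y] of the cross section receives mass from the [k^-1 y]; mass
    transport turns what is received into what is sent, and every pair is selected
    by exactly one [k], so that the total factor is 1. *)
Lemma spread_mecke : mecke m mu nu.
Proof.
move=> F mF F0.
rewrite muE; last 2 first.
- exact: (measurable_orbit_sum bact en).
- by move=> x; exact: orbit_sum_ge0.
have m22 : measurable_fun setT
    (fun p : borel_group G * (borel_group G * X) => p.2.2).
  exact: measurableT_comp measurable_snd measurable_snd.
have m21 : measurable_fun setT
    (fun p : borel_group G * (borel_group G * X) => p.2.1).
  exact: measurableT_comp measurable_fst measurable_snd.
(* the integral of [K] over its first variable is the mass that [k^-1 z] sends to [z] *)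
pose K (q : borel_group G * (borel_group G * X)) :=
  F (q.1, q.2.2) * (\1_S ((q.2.1^-1 * q.1)%g, act (q.2.1^-1)%g q.2.2))%:E.
have mK : measurable_fun setT K.
  apply: emeasurable_funM.
    by apply: measurableT_comp mF _; exact: measurable_fun_pair measurable_fst m22.
  apply: mIS; apply: measurable_fun_pair.
    apply: (measurable_fun_mulg bV); last exact: measurable_fst.
    exact: measurable_fun_invg m21.
  exact: measurableT_comp (measurable_act_inv bact) measurable_snd.
have K0 q : 0 <= K q by apply: mule_ge0; rewrite ?lee_fin.
pose H p := \int[m]_g K (g, p).
have mH : measurable_fun setT H.
  apply: (@measurable_fun_fubini_tonelli_F _ _ _ _ _ m (fun p => K (p.2, p.1))).
    apply: measurableT_comp mK _.
    exact: measurable_fun_pair measurable_snd measurable_fst.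
  by move=> p.
have H0 p : 0 <= H p by exact: integral_ge0.
transitivity (\int[nu]_y orbit_sum act (cs_set Y) H (cs_val y)).
  apply: eq_integral => y _.
  pose L (q : borel_group G * (borel_group G * X)) :=
    F ((q.2.1 * q.1)%g, q.2.2) * (\1_S (q.1, cs_val y))%:E.
  have mL : measurable_fun setT L.
    apply: emeasurable_funM.
      apply: measurableT_comp mF _; apply: measurable_fun_pair => //.
      exact: (measurable_fun_mulg bV m21 measurable_fst).
    apply: mIS; apply: measurable_fun_pair; first exact: measurable_fst.
    exact: measurable_cst.
  have L0 q : 0 <= L q by apply: mule_ge0; rewrite ?lee_fin.
  transitivity (\int[m]_g orbit_sum act (cs_set Y) (fun q => L (g, q)) (cs_val y)).
    apply: eq_integral => g _; rewrite (orbit_sum_act bact) invgK.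
    rewrite indicE; case: (boolP (_ \in S)) => Sgy.
      rewrite mule1; apply: eq_esum => k _.
      by rewrite /L /= indicE Sgy mule1.
    rewrite mule0 /orbit_sum esum1 // => k _.
    by rewrite /L /= indicE (negbTE Sgy) mule0.
  apply: etrans (integral_orbit_sum en _ _ mL L0) _.
  apply: eq_esum => k _; rewrite /H.
  have mKk : measurable_fun setT (fun g => K (g, (k, act k (cs_val y)))).
    by apply: measurableT_comp mK _; exact: pair2_measurable.
  rewrite -(haar_integral_left bV haar_m k mKk) //.
  apply: eq_integral => g _; rewrite /L /K /=.
  by rewrite mulKg actK.
rewrite mass_transport //; apply: eq_integral => y _.
pose L (q : borel_group G * (borel_group G * X)) :=
  F (q.1, cs_val y) * (\1_S ((q.2.1 * q.1)%g, q.2.2))%:E.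
have mL : measurable_fun setT L.
  apply: emeasurable_funM.
    apply: measurableT_comp mF _; apply: measurable_fun_pair; first exact: measurable_fst.
    exact: measurable_cst.
  apply: mIS; apply: measurable_fun_pair => //.
  exact: (measurable_fun_mulg bV m21 measurable_fst).
have L0 q : 0 <= L q by apply: mule_ge0; rewrite ?lee_fin.
transitivity (orbit_sum act (cs_set Y) (fun q => \int[m]_g L (g, q)) (cs_val y)).
  apply: eq_esum => k _; rewrite /H; apply: eq_integral => g _.
  by rewrite /K /L /= actK invgK.
rewrite -(integral_orbit_sum en) //; apply: eq_integral => g _.
exact: (orbit_sum_selected bact Ybeta (f := fun=> F (g, cs_val y)) g).
Qed.

(** Right invariance of Haar measure changes the selection defining [mu] into a
    translate of it, which defines the same measure by [mecke_measureE]. *)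
Lemma spread_invariant (h : G) (A : set X) : measurable A ->
  pushforward mu (act h) A = mu A.
Proof.
move=> mA; have mact := measurable_act bact h.
have mhA : measurable (act h @^-1` A).
  by rewrite -[X in measurable X]setTI; exact: mact.
have mI B : measurable B -> measurable_fun setT (fun x : X => (\1_B x)%:E : \bar R).
  by move=> mB; apply/measurable_EFinP; exact: measurable_indic.
have I0 B (x : X) : 0 <= (\1_B x)%:E :> \bar R by rewrite lee_fin.
have muI B : measurable B -> mu B = \int[mu]_x (\1_B x)%:E.
  by move=> mB; rewrite integral_indic // setIT.
rewrite /pushforward !muI // muE; [|exact: mI|exact: I0].
rewrite (mecke_measureE bV hG bact spread_mecke mbeta Ybeta (mI _ mA) (I0 A) h).
apply: eq_integral => y _.
rewrite -(haar_integral_right bV uG haar_m h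
  (F := fun g => (\1_(act h @^-1` A) (act (g^-1)%g (cs_val y)))%:E *
    (\1_S (g, cs_val y))%:E)).
- apply: eq_integral => g _.
  by rewrite preimage_indicE -(act_mul bact) invgM mulVKg.
- have mp : measurable_fun setT (fun g : borel_group G => (g, cs_val y)).
    exact: pair2_measurable.
  apply: emeasurable_funM; last exact: mIS.
  exact: measurableT_comp (mI _ mhA) (measurableT_comp (measurable_act_inv bact) mp).
- by move=> g; apply: mule_ge0; rewrite ?lee_fin.
Qed.

(** The number of returns [g] in a set of finite Haar measure to a set of finite
    [nu]-measure has a finite integral. *)
Lemma spread_sigma_finite : sigma_finite setT mu.
Proof.
have [M UM HM] := sigma_finiteT m; have [N UN HN] := sigma_finiteT nu.
pose F (i : nat * nat) (p : borel_group G * X) : \bar R :=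
  (\1_(M i.1) p.1)%:E * (\1_(N i.2) (cs_retract Y p.2))%:E.
have mF i : measurable_fun setT (F i).
  have [mM _] := HM i.1; have [mN _] := HN i.2.
  have mr2 : measurable_fun setT (fun p : borel_group G * X => cs_retract Y p.2).
    exact: measurableT_comp mret measurable_snd.
  apply: emeasurable_funM; last exact: measurable_indic_comp.
  by apply: (@measurable_indic_comp _ _ _ _ _ fst) mM; exact: measurable_fst.
have F0 i p : 0 <= F i p by apply: mule_ge0; rewrite lee_fin.
apply: (@sigma_finite_integral _ _ _ mu (nat * nat)%type
  (fun i => orbit_sum act (cs_set Y) (F i))).
- by move=> i; exact: (measurable_orbit_sum bact en).
- by move=> i x; exact: orbit_sum_ge0.
- move=> i; rewrite spread_mecke //.
  have [mM Moo] := HM i.1; have [mN Noo] := HN i.2.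
  have -> : \int[nu]_y \int[m]_g F i (g, cs_val y) =
      \int[nu]_y (m (M i.1) * (\1_(N i.2) y)%:E).
    apply: eq_integral => y _; rewrite /F /= cs_valK ge0_integralZr //.
      by rewrite integral_indic // setIT.
    by apply/measurable_EFinP; exact: measurable_indic.
  rewrite ge0_integralZl //; last by apply/measurable_EFinP; exact: measurable_indic.
  rewrite integral_indic // setIT.
  by apply: lte_mul_pinfty => //; rewrite ge0_fin_numE.
- move=> x; have : (\bigcup_n M n) (beta x) by rewrite -UM.
  have : (\bigcup_n N n) (cs_retract Y (act (beta x) x)) by rewrite -UN.
  move=> [j _ Nj] [i _ Mi]; exists (i, j).
  apply: lt_le_trans (le_esum_one (t := beta x) (Ybeta x) _) => //.
  by rewrite /F /= !indicE !mem_set // mule1.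
Qed.

End converse.

Local Close Scope ereal_scope.

(* Library measures are defined on all sets, so two Borel measures are the same
   when they agree on measurable sets, which is [measure_eq]. *)
Theorem theorem4p3 (R : realType) (G : topologicalGroupType)
    (lcG : locally_compact [set: G]) (hG : hausdorff_space G)
    (scG : @second_countable G) (uG : unimodular R G)
    (m : {measure set (borel_group G) -> \bar R}) (haar_m : haar_measure m)
    (d : measure_display) (X : measurableType d) (sX : standard_borel R X)
    (act : G -> X -> X) (bact : borel_action act) (Y : cross_section act)
    (w : borel_group G -> \bar R) (hw : transverse_weight m w) :
  [/\ (forall mu : {sigma_finite_measure set X -> \bar R},
         action_invariant act mu ->
         exists nu : {sigma_finite_measure set Y -> \bar R},
           [/\ orbit_rel_invariant nu,
               is_transverse_measure w mu nu &
               forall nu' : {measure set Y -> \bar R},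
                 is_transverse_measure w mu nu' -> measure_eq nu' nu]),
      (forall (mu1 mu2 : {sigma_finite_measure set X -> \bar R})
              (nu1 nu2 : {sigma_finite_measure set Y -> \bar R}),
         action_invariant act mu1 -> action_invariant act mu2 ->
         is_transverse_measure w mu1 nu1 -> is_transverse_measure w mu2 nu2 ->
         measure_eq nu1 nu2 -> measure_eq mu1 mu2) &
      (forall nu : {sigma_finite_measure set Y -> \bar R},
         orbit_rel_invariant nu ->
         exists mu : {sigma_finite_measure set X -> \bar R},
           action_invariant act mu /\ is_transverse_measure w mu nu)].
Proof.
have [V bV] := second_countable_base scG.
have sfm : sigma_finite setT m.
  have [K [cK covK]] := compact_exhaustion lcG bV.
  exists K; first by rewrite eqEsubset; split=> // g _; have [i Ki] := covK g; exists i.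
  move=> i; split; last exact: (haar_compact_fin haar_m).
  by apply: closed_borel; exact: compact_closed.
have [m' mE] := sigma_finite_measureP sfm.
have haar_m' : haar_measure m' by rewrite mE.
have hw' : transverse_weight m' w by rewrite mE.
have [U aX] := standard_borel_analytic sX.
have diagX := analytic_space_diag aX.
have [D [gam en]] := return_set_enumeration lcG hG bV aX bact Y.
split.
- move=> mu inv.
  have [nu mk] := mecke_exists bV hG lcG uG haar_m' bact en inv.
  have [nu' nuE] := sigma_finite_measureP (mecke_sigma_finite bV hG haar_m' bact en mk).
  have tr : is_transverse_measure w mu nu by exact: mecke_transverse mk hw'.
  have nuE' A : nu' A = nu A by rewrite -nuE.
  exists nu'; split.
  + move=> A B tau mA mB mtau bij orb.
    apply: etrans (nuE' A) (etrans _ (esym (nuE' B))).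
    exact: (mecke_orbit_invariant bV haar_m' bact diagX en hw' mk) mA mB mtau bij orb.
  + by rewrite nuE.
  + move=> nu'' tr'' A mA; apply: etrans _ (esym (nuE' A)).
    have mI : measurable_fun setT (fun y => (\1_A y)%:E : \bar R).
      by apply/measurable_EFinP; exact: measurable_indic.
    have I0 y : (0 <= (\1_A y)%:E :> \bar R)%E by rewrite lee_fin.
    have := tr'' _ mI I0; rewrite -(tr _ mI I0).
    by rewrite !integral_indic // !setIT.
- move=> mu1 mu2 nu1 nu2 inv1 inv2 tr1 tr2.
  apply: (mecke_injective bV hG bact en).
    exact: (transverse_mecke bV uG haar_m' bact en inv1 hw' tr1).
  exact: (transverse_mecke bV uG haar_m' bact en inv2 hw' tr2).
- move=> nu inv.
  have [beta mbeta Ybeta] := return_selector en.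
  have [mu muE] := spread_measure bV hG m' bact nu mbeta.
  have mk := spread_mecke bV hG haar_m' bact en inv mbeta Ybeta muE.
  have sf := spread_sigma_finite bV hG haar_m' bact en inv mbeta Ybeta muE.
  have [mu' muE'] := sigma_finite_measureP sf.
  exists mu'; split.
    move=> g A mA.
    have := spread_invariant bV hG uG haar_m' bact en inv mbeta Ybeta muE g mA.
    by rewrite -muE'.
  by rewrite muE'; exact: mecke_transverse mk hw'.
Qed.
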